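(* Let $(A,B)$ be a Katsura pair with $B\in M_N(\{0,1\})$ such that the KEP-action $(G_B,E_A)$ is regular. Then every connected component of $\mathcal{J}_{G_B,E_A}$ is either a point or a circle. Moreover, let $C$ be the connectivity matrix of $E_A$, let $\pi:E_A^{-\infty}\to E_C^{-\infty}$ and $\pi_{\mathcal J}:\mathcal{J}_{G_B,E_A}\to E_C^{-\infty}$ be the induced factor maps, and for $v\in E_C^{-\infty}$ let $K(v)=-\min\{k<0: B_{v_{k-1},v_k}=0\}$ (so $K(v)=\infty$ if $B_{v_{k-1},v_k}=0$ for infinitely many $k$), with $K(v)=0$ if this set is empty. Then: (1) if $K(v)=\infty$, then $\pi_{\mathcal J}^{-1}(v)$ is homeomorphic to $\pi^{-1}(v)$, and under this identification $\tilde\sigma$ is the shift $\sigma:\pi^{-1}(v)\to\pi^{-1}(\sigma(v))$; (2) if $K(v)=0$ and $\sup_{k<0}A_{v[k,-1]}=\infty$, then $\pi_{\mathcal J}^{-1}(v)$ is homeomorphic to a circle $\mathbb{T}_v=\{z\in\mathbb{C}:|z|=1\}$, and under these identifications $\tilde\sigma$ is $z\mapsto z^n:\mathbb{T}_v\to\mathbb{T}_{\sigma(v)}$ with $n=A_{v_{-2},v_{-1}}$; (3) if $K(v)=0$ and $\sup_{k<0}A_{v[k,-1]}<\infty$, then $\pi_{\mathcal J}^{-1}(v)$ is a single point; (4) if $0<K(v)<\infty$, then writing $K=K(v)$, $\pi_{\mathcal J}^{-1}(v)$ is homeomorphic to $\pi_{\mathcal J}^{-1}(\sigma^{K}(v))\times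 P_v$, where $P_v$ is the finite set of paths $\mu_{-K}\cdots\mu_{-1}$ in $E_A$ lying over the last $K$ edges of $v$, and cases (2) and (3) describe $\pi_{\mathcal J}^{-1}(\sigma^K(v))$; under these identifications $\tilde\sigma$ is $\mathrm{id}\times\sigma:\pi_{\mathcal J}^{-1}(\sigma^K(v))\times P_v\to\pi_{\mathcal J}^{-1}(\sigma^K(v))\times P_{\sigma(v)}$, $(z,\mu_{-K}\cdots\mu_{-1})\mapsto(z,\mu_{-K}\cdots\mu_{-2})$.
   Context: Katsura pair: $N\in\mathbb{N}$, $A\in M_N(\mathbb{N})$ (nonnegative integers), $B\in M_N(\mathbb{Z})$ with $A_{ij}=0\Rightarrow B_{ij}=0$. Graph $E_A$: vertices $\{1,\dots,N\}$, edges $e_{i,j,m}$ for $0\le m<A_{ij}$, $r(e_{i,j,m})=i$, $s(e_{i,j,m})=j$. Finite paths $\mu_1\cdots\mu_n$ with $s(\mu_i)=r(\mu_{i+1})$; $E^{-\infty}$ = left-infinite paths $\cdots\mu_{-2}\mu_{-1}$ with product topology, shift $\sigma(\cdots\mu_{-2}\mu_{-1})=\cdots\mu_{-3}\mu_{-2}$. The group bundle $\mathbb{Z}\times E_A^0$ (elements $a_i^k$, $a_i^ka_i^l=a_i^{k+l}$) acts by $a_i^k\cdot e_{i,j,m}=e_{i,j,\hat m}$, $a_i^k|_{e_{i,j,m}}=a_j^{\hat k}$, where $kB_{ij}+m=\hat kA_{ij}+\hat m$ and $0\le\hat m<A_{ij}$; this extends to finite paths via $g\cdot(e\nu)=(g\cdot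 e)(g|_e\cdot\nu)$, $g|_{e\nu}=(g|_e)|_\nu$. $G_B$ is the quotient by the elements acting trivially; $(G_B,E_A)$ (the KEP-action) is a faithful self-similar groupoid action, with restrictions descending to $G_B$. Regular: for every $g\in G_B$ there is $K\in\mathbb{N}$ such that $g\cdot\mu=\mu$ and $|\mu|\ge K$ imply $g|_\mu$ is the unit at $s(\mu)$. Limit space: $\mu\sim_{ae}\nu$ in $E_A^{-\infty}$ iff there are a finite $F\subseteq G_B$ and $(g_n)_{n<0}\subseteq F$ with $d(g_n)=r(\mu_n)$ and $g_n\cdot\mu_n\cdots\mu_{-1}=\nu_n\cdots\nu_{-1}$ for all $n<0$; $\mathcal{J}_{G_B,E_A}=E_A^{-\infty}/\sim_{ae}$ (quotient topology), $\tilde\sigma$ induced by $\sigma$. Connectivity matrix: $C_{ij}=1$ if $A_{ij}>0$ and $0$ otherwise; $E_C$ is its graph (one edge $i\to j$ from range $i$ to source $j$ whenever $A_{ij}>0$). $\pi$ sends each edge $e_{i,j,m}$ to the edge of $E_C$ with range $i$ and source $j$; since the action preserves ranges and sources of edges, $\pi$ descends to $\pi_{\mathcal J}$. For $v=\cdots f_{-2}f_{-1}\in E_C^{-\infty}$ write $v_k=s(f_k)$ for $k\le-1$, so $r(f_k)=v_{k-1}$, and $A_{v[k,-1]}=\prod_{j=k}^{-1}A_{v_{j-1},v_j}$. *)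

(* Defs.v *)
From HB Require Import structures.
From mathcomp Require Import all_boot all_order all_algebra.
From mathcomp Require Import all_classical all_reals all_analysis.
From mathcomp Require Import Rstruct Rstruct_topology.
Import Order.TTheory GRing.Theory Num.Theory.
Local Open Scope classical_set_scope.
Local Open Scope quotient_scope.

Section Katsura.
Variables (N : nat) (A : 'M[nat]_N) (B : 'M[int]_N).

(* An edge label (i, j, m) stands for e_{i,j,m}: range i, source j.
   It is an actual edge of E_A iff m < A_{ij}. *)
Definition Lbl := ('I_N * 'I_N * nat)%type.
Definition lr (e : Lbl) : 'I_N := e.1.1.
Definition ls (e : Lbl) : 'I_N := e.1.2.
Definition lm (e : Lbl) : nat := e.2.
Definition is_edge (e : Lbl) : bool := (lm e < A (lr e) (ls e))%N.

Fixpoint is_fpath (i : 'I_N) (p : seq Lbl) : bool :=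
  match p with
  | [::] => true
  | e :: p' => [&& lr e == i, is_edge e & is_fpath (ls e) p']
  end.

(* the element a_i^k is the pair (i, k); d(a_i^k) = i *)
Definition Gb := ('I_N * int)%type.

(* a_i^k . e_{i,j,m} = e_{i,j,mhat},  a_i^k|_{e_{i,j,m}} = a_j^{khat},
   where k B_ij + m = khat A_ij + mhat, 0 <= mhat < A_ij *)
Definition act_edge (g : Gb) (e : Lbl) : Lbl * Gb :=
  let a : int := Posz (A (lr e) (ls e)) in
  let t : int := (g.2 * B (lr e) (ls e) + Posz (lm e))%R in
  ((lr e, ls e, `|(t %% a)%Z|%N), (ls e, (t %/ a)%Z)).

Fixpoint act (g : Gb) (p : seq Lbl) : seq Lbl :=
  match p with
  | [::] => [::]
  | e :: p' => (act_edge g e).1 :: act (act_edge g e).2 p'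
  end.

Fixpoint res (g : Gb) (p : seq Lbl) : Gb :=
  match p with
  | [::] => g
  | e :: p' => res (act_edge g e).2 p'
  end.

(* g is trivial in G_B (i.e. is the unit at d(g)): it fixes every finite
   path with range d(g). *)
Definition acts_trivially (g : Gb) : Prop :=
  forall p, is_fpath g.1 p -> act g p = p.

(* Regularity (every element of G_B is the class of some (i,k)). *)
Definition regular : Prop :=
  forall g : Gb, exists K : nat, forall p : seq Lbl,
    is_fpath g.1 p -> (K <= size p)%N -> act g p = p ->
    acts_trivially (res g p).

(* x k represents mu_{-(k+1)}; product topology of discrete spaces *)
Definition Seq := {ptws nat -> discrete_topology Lbl}.
Definition is_linf : set Seq :=
  [set x | forall k, is_edge (x k) /\ ls (x k.+1) = lr (x k)].
Definition Einf := set_type is_linf.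

(* mu_n ... mu_{-1} for n = -(k+1), as a finite path *)
Definition seg (x : Seq) (k : nat) : seq Lbl :=
  [seq x (k - t)%N | t <- iota 0 k.+1].

Definition shiftS (x : Seq) : Seq := fun k => x k.+1.
Definition shiftE (x : Einf) : Einf := insubd x (shiftS (val x)).

Definition ae (x y : Einf) : Prop :=
  exists F : seq Gb, exists g : nat -> Gb, forall k : nat,
    [/\ g k \in F, (g k).1 = lr (val x k) &
        act (g k) (seg (val x) k) = seg (val y) k].

Definition Jcls := {S : set Einf | exists x, S = ae x}.
Definition Jpi (x : Einf) : Jcls := exist _ (ae x) (ex_intro _ x erefl).
Definition Jrepr (q : Jcls) : Einf := projT1 (cid (proj2_sig q)).
Lemma JreprK : cancel Jrepr Jpi.
Proof.
move=> [S HS]; rewrite /Jrepr /Jpi /=.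
case: (cid HS) => x /= Hx; subst S.
by congr exist; exact: Prop_irrelevance.
Qed.
HB.instance Definition _ := isQuotient.Build Einf Jcls JreprK.

Local Notation J := (quotient_topology Jcls).
Definition qpi (x : Einf) : J := \pi_J x.
Definition sigmaJ (q : J) : J := qpi (shiftE (repr q)).

(* an edge of E_C is identified with its pair (range, source) *)
Definition SeqC := (nat -> ('I_N * 'I_N))%type.
Definition is_linfC (v : SeqC) : Prop :=
  forall k, (0 < A (v k).1 (v k).2)%N /\ (v k.+1).2 = (v k).1.
Definition shiftC (v : SeqC) : SeqC := fun k => v k.+1.
Definition piE (x : Einf) : SeqC := fun k => (lr (val x k), ls (val x k)).
Definition piJ (q : J) : SeqC := piE (repr q).
Definition fiber (v : SeqC) : set Einf := [set x | piE x = v].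
Definition fiberJ (v : SeqC) : set J := [set q | piJ q = v].

(* B evaluated at the edge f_{-(k+1)} = v k, i.e. B_{v_{-k-2}, v_{-k-1}} *)
Definition Bv (v : SeqC) (k : nat) : int := B (v k).1 (v k).2.
Definition K_infinite (v : SeqC) : Prop :=
  forall n : nat, exists2 k : nat, (n <= k)%N & Bv v k = 0.
(* K(v) = K (finite; K = 0 means the set is empty) *)
Definition K_is (v : SeqC) (K : nat) : Prop :=
  (forall k : nat, (K <= k)%N -> Bv v k <> 0) /\
  ((0 < K)%N -> Bv v K.-1 = 0).
Definition Aprod (v : SeqC) (n : nat) : nat :=
  (\prod_(k < n) A (v k).1 (v k).2)%N.
Definition Aprod_unbounded (v : SeqC) : Prop :=
  forall M : nat, exists n : nat, (0 < n)%N /\ (M < Aprod v n)%N.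

(* P_v : paths mu_{-K} ... mu_{-1} (listed left to right) over the last K
   edges of v *)
Definition Pv (v : SeqC) (K : nat) : set (discrete_topology (seq Lbl)) :=
  [set s | size s = K /\ forall t : nat, (t < K)%N ->
     let e := nth ((v 0%N).1, (v 0%N).2, 0%N) s t in
     is_edge e /\ (lr e, ls e) = v (K - 1 - t)%N].
Definition dropLast (s : seq Lbl) : seq Lbl := take (size s).-1 s.
End Katsura.
Notation J A B := (quotient_topology (Jcls _ A B)).

Definition homeo_on {X Y : topologicalType} (f : X -> Y) (S : set X) (T : set Y)
  : Prop :=
  exists g : Y -> X,
    [/\ (forall x, S x -> T (f x)), (forall y, T y -> S (g y)),
        (forall x, S x -> g (f x) = x) & (forall y, T y -> f (g y) = y)] /\
    {within S, continuous f} /\ {within T, continuous g}.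

Definition Cplx := (Rdefinitions.R * Rdefinitions.R)%type.
Definition circle : set Cplx :=
  [set z | (z.1 ^+ 2 + z.2 ^+ 2 = 1)%R].
Definition cmul (z w : Cplx) : Cplx :=
  ((z.1 * w.1 - z.2 * w.2)%R, (z.1 * w.2 + z.2 * w.1)%R).
Definition cpow (z : Cplx) (n : nat) : Cplx := iter n (cmul z) (1%R, 0%R).

(* Main.v *)
Require Import Defs.
From HB Require Import structures.
From mathcomp Require Import all_boot all_order all_algebra.
From mathcomp Require Import all_classical all_reals all_analysis.
From mathcomp Require Import Rstruct Rstruct_topology.
From mathcomp Require Import zify ring lra.
Import Order.TTheory GRing.Theory Num.Theory.
Local Open Scope classical_set_scope.

(** Along a path [v] of E_C on which [B] is 1, [a_i^k] acts as an odometer: it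
    adds [k] to the integer [num] whose mixed radix digits (bases [A]) are the
    edge labels, the first edge carrying the least significant digit.  With
    [P_n] the product of the last [n] bases, [mu ~ nu] therefore says that
    [num_n mu - num_n nu] is bounded modulo [P_n] uniformly in [n].  If [P_n] is
    unbounded this means that the reals [theta = lim num_n / P_n] of [mu] and
    [nu] agree modulo 1, whence the circle, and dropping the last edge turns
    [theta] into [A theta] modulo 1; if [P_n] is bounded all paths over [v] are
    equivalent.  An edge with [B = 0] resets the restriction to a unit, so that
    everything to its right is fixed: infinitely many zeros make [~] trivial on
    the fibre, and finitely many split off the discrete factor [P_v].

    Fibres are closed and saturated in a compact space, hence every map defined
    on paths induces maps on fibres of the quotient with the right topology.
    Each edge of the path in E_C is locally constant on the limit space, and on
    each fibre so are the edges right of the last zero; this determines the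
    connected components. *)

(* [generic_quotient] also exports a [piE]. *)
Local Notation piE := Defs.piE.

(** * Action on finite words and asymptotic equivalence *)

Section Words.
Variables (N : nat) (A : 'M[nat]_N) (B : 'M[int]_N).

(* Largest index first, so that [seg x k] is [word x k.+1]. *)
Definition word (x : nat -> Lbl N) (n : nat) : seq (Lbl N) := rev (mkseq x n).

Lemma wordS x n : word x n.+1 = x n :: word x n.
Proof. by rewrite /word mkseqS rev_rcons. Qed.

Lemma size_word x n : size (word x n) = n.
Proof. by rewrite size_rev size_mkseq. Qed.

Lemma seg_word (x : Seq N) k : seg N x k = word x k.+1.
Proof.
rewrite /seg /word; apply: (@eq_from_nth _ (x 0%N)).
  by rewrite size_map size_iota size_rev size_mkseq.
move=> t; rewrite size_map size_iota => ltk.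
rewrite (nth_map 0%N) ?size_iota // nth_iota // nth_rev ?size_mkseq //.
by rewrite nth_mkseq; [congr x; lia | lia].
Qed.

Lemma wordD x n K : word x (n + K) = word (fun k => x (k + K)%N) n ++ word x K.
Proof. by elim: n => [|n IH] //=; rewrite addSn !wordS IH. Qed.

Lemma eq_wordP x y n : word x n = word y n <-> forall k, (k < n)%N -> x k = y k.
Proof.
elim: n => [|n IH]; first by split.
rewrite !wordS; split=> [[e /IH h] k|h].
  by rewrite ltnS leq_eqVlt => /orP[/eqP-> //|/h].
congr (_ :: _); first exact: h.
by apply/IH => k kn; apply: h; rewrite ltnW.
Qed.

Lemma act_fst i j k p : act N A B (i, k) p = act N A B (j, k) p.
Proof. by case: p. Qed.

Lemma act_cons g e p : act N A B g (e :: p) =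
  (act_edge N A B g e).1 :: act N A B (act_edge N A B g e).2 p.
Proof. by []. Qed.

Lemma act_cat g p q :
  act N A B g (p ++ q) = act N A B g p ++ act N A B (res N A B g p) q.
Proof. by elim: p g => //= e p IH g; rewrite IH. Qed.

Lemma size_act g p : size (act N A B g p) = size p.
Proof. by elim: p g => //= e p IH g; rewrite IH. Qed.

Lemma act_ranges g p :
  [seq (lr N e, ls N e) | e <- act N A B g p] = [seq (lr N e, ls N e) | e <- p].
Proof. by elim: p g => //= e p IH g; rewrite IH. Qed.

(** Dividing [lm e < A] by [A] has quotient 0 and remainder [lm e]. The product condition covers
    both a zero exponent and an edge with [B = 0]. *)
Lemma act_edge0 g e : is_edge N A e -> (g.2 * B (lr N e) (ls N e) = 0)%R ->
  act_edge N A B g e = (e, (ls N e, 0%R)).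
Proof.
rewrite /is_edge /act_edge => lt_e ->; case: e lt_e => [[i j] m] /= lt_m.
rewrite /lr /ls /lm /= in lt_m *; rewrite add0r modz_small ?divz_small //=; lia.
Qed.

Lemma act0 i p : all (is_edge N A) p -> act N A B (i, 0%R) p = p.
Proof.
elim: p i => // e p IH i /andP[he /IH{}IH].
by rewrite act_cons act_edge0 ?mul0r //= IH.
Qed.

(** Adding [l * b] and then [k * b] gives the same digit as adding both at once, and the two carries
    add up: the cocycle rule for restrictions. *)
Lemma act_edgeD i k l e : is_edge N A e ->
  (act_edge N A B (i, k) (act_edge N A B (i, l) e).1).1 =
    (act_edge N A B (i, (k + l)%R) e).1 /\
  ((act_edge N A B (i, k) (act_edge N A B (i, l) e).1).2.2 +
     (act_edge N A B (i, l) e).2.2)%R = (act_edge N A B (i, (k + l)%R) e).2.2.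
Proof.
rewrite /is_edge /act_edge; case: e => [[i' j] m]; rewrite /lr /ls /lm /= => lt_m.
set a : int := A i' j; set b := B i' j.
have a0 : (a != 0)%R by rewrite /a; lia.
rewrite gez0_abs ?modz_ge0 //.
(* The first division contributes a multiple of [a], which leaves the remainder alone and passes
   into the quotient. *)
have E : ((k + l) * b + m = ((l * b + m) %/ a)%Z * a
             + (k * b + ((l * b + m) %% a)%Z))%R.
  have h := divz_eq (l * b + m)%R a; rewrite mulrDl -addrA [X in (_ + X = _)%R]h; ring.
by rewrite E modzMDl divzMDl //; split=> //; rewrite addrC.
Qed.

Lemma actD i k l p : all (is_edge N A) p ->
  act N A B (i, k) (act N A B (i, l) p) = act N A B (i, (k + l)%R) p.
Proof.
elim: p i k l => // e p IH i k l /andP[he hp]; rewrite !act_cons.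
have [-> e2] := act_edgeD i k l e he; congr (_ :: _).
move: e2; case: (act_edge N A B (i, l) e) => f [j g]; rewrite [(f, _).1]/=.
case: (act_edge N A B (i, k) f) => f' [j' g'].
case: (act_edge N A B _ e) => f'' [j'' g''] /= <-.
by rewrite (act_fst j' j) IH //; exact: act_fst.
Qed.

End Words.

Section AsymptoticEquivalence.
Variables (N : nat) (A : 'M[nat]_N) (B : 'M[int]_N).
Implicit Types (x y z : Einf N A) (v : SeqC N).

Lemma Einf_edge x k : is_edge N A (val x k).
Proof. by case: x => x /= /set_mem /(_ k)[]. Qed.

Lemma all_edge_word x n : all (is_edge N A) (@word N (val x) n).
Proof. by elim: n => // n IH; rewrite wordS /= Einf_edge. Qed.

Lemma val_shiftE x k : val (shiftE N A x) k = val x k.+1.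
Proof.
rewrite /shiftE insubdK // inE => n /=.
by case: x => x /= /set_mem /(_ n.+1).
Qed.

Lemma val_iter_shiftE x K k : val (iter K (shiftE N A) x) k = val x (k + K)%N.
Proof.
by elim: K k => [|K IH] k /=; rewrite ?addn0 // val_shiftE IH addnS.
Qed.

Lemma Einf_inj x y : (forall k, val x k = val y k) -> x = y.
Proof. by move=> h; apply: val_inj; apply/funext. Qed.

(* The vertex of each [g_n] is forced, so finiteness of [F] is a bound on exponents. *)
Lemma aeP x y : ae N A B x y <-> exists C : nat, forall n, exists2 k : int,
  (`|k| <= C)%N & forall i, act N A B (i, k) (@word N (val x) n) = @word N (val y) n.
Proof.
split=> [[F [g h]]|[C h]].
  exists (\max_(f <- F) `|f.2|%N) => -[|n]; first by exists 0%R.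
  have [gF _] := h n; rewrite !seg_word => gact; exists (g n).2.
    by apply: (@leq_bigmax_seq _ _ xpredT (fun f : Gb N => `|f.2|%N)).
  by move=> i; rewrite -gact; case: (g n) => j k; exact: act_fst.
have /boolp.choice[w hw] n : exists k : int, (`|k| <= C)%N /\ forall i,
    act N A B (i, k) (@word N (val x) n) = @word N (val y) n.
  by have [k kC e] := h n; exists k.
(* All [a_i^c] with [|c| <= C]: a finite set containing every element used. *)
exists [seq (i, c) | i <- enum 'I_N,
         c <- [seq (j%:Z - C%:Z)%R | j <- iota 0 (2 * C).+1]].
exists (fun n => (lr N (val x n), w n.+1)) => n.
have [cC cact] := hw n.+1; rewrite !seg_word; split=> //.
apply/allpairsP; exists (lr N (val x n), w n.+1); split=> //; first exact: mem_enum.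
apply/mapP; exists `|(w n.+1 + C)%R|%N; first by rewrite mem_iota; lia.
by move=> /=; lia.
Qed.

Lemma ae_refl x : ae N A B x x.
Proof.
by apply/aeP; exists 0%N => n; exists 0%R => // i; rewrite act0 ?all_edge_word.
Qed.

Lemma ae_sym x y : ae N A B x y -> ae N A B y x.
Proof.
move=> /aeP[C h]; apply/aeP; exists C => n; have [k kC e] := h n.
exists (- k)%R => [|i]; first lia.
by rewrite -(e i) actD ?all_edge_word // addNr act0 ?all_edge_word.
Qed.

Lemma ae_trans x y z : ae N A B x y -> ae N A B y z -> ae N A B x z.
Proof.
move=> /aeP[C h] /aeP[D h']; apply/aeP; exists (C + D)%N => n.
have [k kC e] := h n; have [l lD e'] := h' n.
exists (l + k)%R => [|i]; first lia.
by rewrite -actD ?all_edge_word // e e'.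
Qed.

Lemma piE_ae x y : ae N A B x y -> piE N A x = piE N A y.
Proof.
move=> /aeP[C h]; apply/funext => n; have [k _ e] := h n.+1.
have := act_ranges N A B (lr N (val x n), k) (@word N (val x) n.+1).
by rewrite e !wordS /= /piE => -[-> ->].
Qed.

Lemma piE_shift x K k : piE N A (iter K (shiftE N A) x) k = piE N A x (k + K)%N.
Proof. by rewrite /piE val_iter_shiftE. Qed.

(* A zero of [B] at the edge of index [K] kills the restriction, so nothing to
   its right moves. *)
Lemma act_word_zero x K n g : Bv N B (piE N A x) K = 0%R ->
  act N A B g (@word N (val x) (n + K.+1)) =
  act N A B g (@word N (val (iter K.+1 (shiftE N A) x)) n) ++ @word N (val x) K.+1.
Proof.
move=> hB; rewrite wordD act_cat.
have -> : (fun k => val x (k + K.+1)%N) = val (iter K.+1 (shiftE N A) x).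
  by apply/funext => k; rewrite val_iter_shiftE.
congr (_ ++ _); rewrite wordS act_cons act_edge0 ?Einf_edge //.
  by rewrite /= act0 ?all_edge_word.
by move: hB; rewrite /Bv /piE /= => ->; rewrite mulr0.
Qed.

(** By [act_word_zero] a comparison at length [n + K.+1] is one of the shifted paths at length [n],
    followed by two fixed suffixes that must coincide. *)
Lemma ae_zero x y K : piE N A x = piE N A y -> Bv N B (piE N A x) K = 0%R ->
  ae N A B x y <->
  ae N A B (iter K.+1 (shiftE N A) x) (iter K.+1 (shiftE N A) y) /\
  @word N (val x) K.+1 = @word N (val y) K.+1.
Proof.
move=> exy hB.
have wy n : @word N (val y) (n + K.+1) =
    @word N (val (iter K.+1 (shiftE N A) y)) n ++ @word N (val y) K.+1.
  rewrite wordD; congr (_ ++ _); congr word.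
  by apply/funext => k; rewrite val_iter_shiftE.
split=> [/aeP[C h]|[/aeP[C h] exyK]].
  have h' n : exists2 k : int, (`|k| <= C)%N & forall i,
      act N A B (i, k) (@word N (val (iter K.+1 (shiftE N A) x)) n) ++
        @word N (val x) K.+1 =
      @word N (val (iter K.+1 (shiftE N A) y)) n ++ @word N (val y) K.+1.
    have [k kC e] := h (n + K.+1)%N; exists k => // i.
    by rewrite -wy -act_word_zero.
  split; last first.
    have [k _] := h' 0%N; move=> /(_ (lr N (val x 0%N)))/eqP.
    by rewrite eqseq_cat // => /andP[_ /eqP].
  apply/aeP; exists C => n; have [k kC e] := h' n; exists k => // i.
  by move: (e i) => /eqP; rewrite eqseq_cat ?size_act ?size_word // => /andP[/eqP].
(* Lengths up to [K] are served by the exponent 0, as the last [K.+1] edges agree. *)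
apply/aeP; exists C => n; have [ltn|/subnK <-] := ltnP n K.+1.
  exists 0%R => // i; rewrite act0 ?all_edge_word //; apply/eq_wordP => k kn.
  by move/eq_wordP: exyK; apply; exact: ltn_trans kn ltn.
have [k kC e] := h (n - K.+1)%N; exists k => // i.
by rewrite wy act_word_zero // e exyK.
Qed.

Lemma ae_K_infinite x y : K_infinite N B (piE N A x) -> ae N A B x y -> x = y.
Proof.
move=> hK hxy; apply: Einf_inj => n; have [k nk hB] := hK n.
have [_ /eq_wordP] := (ae_zero x y k (piE_ae x y hxy) hB).1 hxy.
by apply; rewrite ltnS.
Qed.

End AsymptoticEquivalence.

(* [mixnum a m n] reads [m (n-1), ..., m 0], least significant digit first, in the
   mixed radix system with bases [a (n-1), ..., a 0]. *)
Fixpoint mixnum (a m : nat -> nat) (n : nat) : nat :=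
  if n is n'.+1 then m n' + a n' * mixnum a m n' else 0.

Lemma mixnum_lt a m n : (forall k, m k < a k)%N -> (mixnum a m n < \prod_(k < n) a k)%N.
Proof.
move=> h; elim: n => [|n IH]; first by rewrite big_ord0.
rewrite big_ord_recr /=.
apply: (@leq_trans (a n * (mixnum a m n).+1)%N); first by rewrite mulnS; have := h n; lia.
by rewrite mulnC leq_mul2r IH orbT.
Qed.

(** A nonzero multiple of [c] has absolute value at least [c], whereas residues in [[0, c)] differ
    by less. *)
Lemma digit_uniq (r w : int) (f c : nat) : (0 <= r)%R -> (r < `|c%:Z|)%R ->
  (f < c)%N -> (r - f%:Z = w * c%:Z)%R -> r = Posz f.
Proof.
move=> r0 rc fc e; have [w0|w0|w0] := ltrgtP w 0%R; last by lia.
  have : ((w + 1) * c%:Z <= 0)%R by apply: mulr_le0_ge0; lia.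
  rewrite mulrDl; lia.
have : (0 <= (w - 1) * c%:Z)%R by apply: mulr_ge0; lia.
rewrite mulrBl; lia.
Qed.

(** * The odometer action along paths on which [B] is 1 *)

Section Odometer.
Variables (N : nat) (A : 'M[nat]_N) (B : 'M[int]_N).
Implicit Types (x y z : Einf N A) (v : SeqC N).

Definition base v (k : nat) : nat := A (v k).1 (v k).2.
Definition dig x (k : nat) : nat := lm N (val x k).

Lemma dig_lt x k : (dig x k < base (piE N A x) k)%N.
Proof. exact: Einf_edge. Qed.

Lemma Einf_dig_inj x y : piE N A x = piE N A y ->
  forall k, dig x k = dig y k -> val x k = val y k.
Proof.
move=> e k; have := congr1 (@^~ k) e; rewrite /piE /dig /lr /ls /lm.
by case: (val x k) => [[? ?] ?]; case: (val y k) => [[? ?] ?] /= [-> ->] ->.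
Qed.

(* [a_i^k] adds [k] to the number read off a path. *)
Lemma act_num x y i k n : piE N A x = piE N A y ->
  (forall l, Bv N B (piE N A x) l = 1%R) ->
  act N A B (i, k) (@word N (val x) n) = @word N (val y) n <->
  ((\prod_(l < n) base (piE N A x) l)%N %|
     ((mixnum (base (piE N A x)) (dig x) n)%:Z + k
       - (mixnum (base (piE N A x)) (dig y) n)%:Z)%R)%Z.
Proof.
move=> exy hB; set a := base _; elim: n i k => [|n IH] i k.
  by rewrite big_ord0 dvd1z.
rewrite !wordS act_cons big_ord_recr /=.
have elr := congr1 (@^~ n) exy; have eB := hB n.
move: (Einf_dig_inj x y exy n) (dig_lt x n) (dig_lt y n).
rewrite -exy -/a -[a n]/(A (lr N (val x n)) (ls N (val x n))) /dig.
move: eB elr; rewrite /Bv /piE /=.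
set e := val x n; set f := val y n => eB elr inj lt_e lt_f.
set c := A _ _ in lt_e lt_f *.
set P := (\prod_(l < n) a l)%N; set nx := mixnum a _ n; set ny := mixnum a _ n.
have c0 : (c%:Z != 0)%R by lia.
(* The restriction to the first edge is the carry, so the rest of the word is compared with the
   carry as exponent. *)
have := IH (ls N e) ((k + lm N e)%R %/ c)%Z.
rewrite -/P -/nx -/ny.
have := divz_eq (k + lm N e)%R c; have := modz_ge0 (k + lm N e)%R c0.
have := @ltz_mod (k + lm N e)%R c c0.
rewrite /act_edge /= eB mulr1 -/c.
set q := ((k + lm N e)%R %/ c)%Z; set r := ((k + lm N e)%R %% c)%Z.
move=> rc r0 dv IHq.
(* The lowest digits are separated from [c] times the comparison of the remaining ones. *)
have E : ((lm N e + c * nx)%:Z + k - (lm N f + c * ny)%:Z =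
          c%:Z * (nx%:Z + q - ny%:Z) + (r - (lm N f)%:Z))%R.
  by rewrite !PoszD !PoszM; move: dv; set t := (k + _)%R => dv; lia.
rewrite E; split.
  case=> ef /IHq /dvdzP[w ->]; apply/dvdzP; exists w.
  have -> : r = Posz (lm N f) by rewrite -ef /lm /=; lia.
  by rewrite PoszM; ring.
move=> h.
(* Reducing modulo [c] forces the lowest digits to agree; cancelling [c] then leaves the inductive
   statement. *)
have erf : r = Posz (lm N f).
  have [w ew] : exists w : int, (r - (lm N f)%:Z = w * c%:Z)%R.
    move/dvdzP: h => [w]; rewrite PoszM => h.
    by exists (w * P%:Z - (nx%:Z + q - ny%:Z))%R; rewrite mulrBl -mulrA -h; ring.
  exact: (digit_uniq _ _ _ _ r0 rc lt_f ew).
move: h; rewrite erf subrr addr0 PoszM mulrC dvdz_mul2r // => /IHq ->.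
congr (_ :: _); move: elr; rewrite -/e -/f => -[-> ->] /=.
by rewrite /lr /ls /lm; case: (f) => [[? ?] ?].
Qed.

Lemma ae_numP x y : piE N A x = piE N A y ->
  (forall l, Bv N B (piE N A x) l = 1%R) ->
  ae N A B x y <-> exists C : nat, forall n, exists2 k : int, (`|k| <= C)%N &
  ((\prod_(l < n) base (piE N A x) l)%N %|
     ((mixnum (base (piE N A x)) (dig x) n)%:Z + k
       - (mixnum (base (piE N A x)) (dig y) n)%:Z)%R)%Z.
Proof.
move=> exy hB; rewrite aeP; split=> -[C h]; exists C => n; have [k kC e] := h n.
  exists k => //; apply/(act_num x y (lr N (val x 0%N))) => //.
by exists k => // i; apply/act_num.
Qed.

(** The exponent is the difference of the two numbers, which is bounded because both lie below a
    bounded product. *)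
Lemma ae_bounded x y : piE N A x = piE N A y ->
  (forall l, Bv N B (piE N A x) l = 1%R) ->
  ~ Aprod_unbounded N A (piE N A x) -> ae N A B x y.
Proof.
move=> exy hB /existsNP[M /forallNP hM]; apply/(ae_numP x y exy hB).
(* The 1 covers the empty product at [n = 0], about which [hM] says nothing. *)
exists (maxn M 1) => n.
exists ((mixnum (base (piE N A x)) (dig y) n)%:Z
        - (mixnum (base (piE N A x)) (dig x) n)%:Z)%R; last first.
  by rewrite [X in (_ %| X)%Z](_ : _ = 0%R) ?dvdz0 //; ring.
have lx := mixnum_lt _ _ n (dig_lt x); have ly := mixnum_lt _ _ n (dig_lt y).
have : (\prod_(l < n) base (piE N A x) l <= maxn M 1)%N.
  case: n {lx ly} => [|n]; first by rewrite big_ord0; lia.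
  rewrite leq_max leqNgt; apply/orP; left; apply/negP => h.
  by apply: (hM n.+1).
rewrite -exy in ly; lia.
Qed.

End Odometer.

(** * Mixed radix expansions of reals *)

Section MixedRadixExpansion.
Variables (R : realType) (a : nat -> nat).
Local Open Scope ring_scope.

Definition radix (n : nat) : nat := (\prod_(k < n) a k)%N.
Definition approx (m : nat -> nat) (n : nat) : R := (mixnum a m n)%:R / (radix n)%:R.
(** The sum of the series [m k / radix k.+1], as the supremum of its nondecreasing partial sums
    [approx m n]. Digit 0 is the most significant. *)
Definition theta (m : nat -> nat) : R := sup (range (approx m)).
Definition digits (m : nat -> nat) : Prop := forall k, (m k < a k)%N.

Hypothesis a_gt0 : forall k, (0 < a k)%N.

Lemma radixS n : radix n.+1 = (radix n * a n)%N.
Proof. by rewrite /radix big_ord_recr. Qed.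

Lemma radix_gt0 n : (0 < radix n)%N.
Proof.
by elim: n => [|n IH]; rewrite ?radixS ?muln_gt0 ?IH ?a_gt0 // /radix big_ord0.
Qed.

Lemma radixR_gt0 n : 0 < (radix n)%:R :> R.
Proof. by rewrite ltr0n radix_gt0. Qed.

Lemma approx0 m : approx m 0 = 0.
Proof. by rewrite /approx /= mul0r. Qed.

Lemma radix0V : (radix 0)%:R^-1 = 1 :> R.
Proof. by rewrite /radix big_ord0 invr1. Qed.

Lemma approxS m n : approx m n.+1 = approx m n + (m n)%:R / (radix n.+1)%:R.
Proof.
rewrite /approx /= radixS !natrD !natrM.
have := radixR_gt0 n; have : 0 < (a n)%:R :> R by rewrite ltr0n.
by move=> *; field; rewrite !gt_eqF.
Qed.

Lemma approx_nondecreasing m : {homo approx m : n k / (n <= k)%N >-> n <= k}.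
Proof.
apply: homo_leq => [//|x y z|n]; first exact: le_trans.
by rewrite approxS lerDl divr_ge0.
Qed.

(** As [m n + 1 <= a n], the next digit refines the interval from [approx m n] to
    [approx m n + 1 / radix n]. *)
Lemma upper_nonincreasing m : digits m ->
  {homo (fun n => approx m n + (radix n)%:R^-1) : n k / (n <= k)%N >-> k <= n}.
Proof.
move=> hm; apply: homo_leq => [//|x y z h h'|n]; first exact: le_trans h' h.
rewrite approxS -addrA lerD2l.
have an : 0 < (a n)%:R :> R by rewrite ltr0n.
have -> : (radix n)%:R^-1 = (a n)%:R / (radix n.+1)%:R :> R.
  rewrite radixS natrM; have := radixR_gt0 n.
  by move=> *; field; rewrite !gt_eqF.
rewrite -[X in _ + X]mul1r -mulrDl ler_pM2r ?invr_gt0 ?radixR_gt0 //.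
by rewrite natr1 ler_nat.
Qed.

Lemma approx_le_upper m n k : digits m -> approx m k <= approx m n + (radix n)%:R^-1.
Proof.
move=> hm; apply: (@le_trans _ _ (approx m (maxn n k))).
  by apply: approx_nondecreasing; rewrite leq_maxr.
apply: le_trans (upper_nonincreasing m hm n (maxn n k) (leq_maxl _ _)).
by rewrite lerDl invr_ge0 ltW ?radixR_gt0.
Qed.

Lemma theta_ge m n : digits m -> approx m n <= theta m.
Proof.
move=> hm; apply: ub_le_sup; last by exists n.
by exists (approx m 0 + (radix 0)%:R^-1) => _ [k _ <-]; exact: approx_le_upper.
Qed.

Lemma theta_le m n : digits m -> theta m <= approx m n + (radix n)%:R^-1.
Proof.
move=> hm; apply: ge_sup; first by exists (approx m 0), 0%N.
by move=> _ [k _ <-]; exact: approx_le_upper.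
Qed.

Lemma theta01 m : digits m -> 0 <= theta m <= 1.
Proof.
move=> hm; have := theta_ge m 0 hm; have := theta_le m 0 hm.
by rewrite approx0 radix0V add0r => -> ->.
Qed.

Hypothesis a_unbounded : forall M, exists n, (M < radix n)%N.

Lemma radix_small (C e : R) : 0 < e -> exists n, C / (radix n)%:R < e.
Proof.
move=> e0; have [n hn] := a_unbounded (Num.bound `|C / e|); exists n.
rewrite ltr_pdivrMr ?radixR_gt0 // mulrC -ltr_pdivrMr //.
apply: le_lt_trans (ler_norm _) _.
apply: lt_trans (archi_boundP (normr_ge0 _)) _.
by rewrite ltr_nat.
Qed.

(** Nested intervals whose lengths [1 / radix n] become arbitrarily small. *)
Lemma theta_uniq m t : digits m ->
  (forall n, approx m n <= t <= approx m n + (radix n)%:R^-1) -> t = theta m.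
Proof.
move=> hm h; apply/eqP; rewrite eq_le; apply/andP; split; apply/ler_addgt0Pr => e e0.
  have [n] := radix_small 1 e e0; rewrite div1r => hn.
  have /andP[_ h1] := h n; have := theta_ge m n hm; lra.
have [n] := radix_small 1 e e0; rewrite div1r => hn.
have /andP[h1 _] := h n; have := theta_le m n hm; lra.
Qed.

(** Greedy expansion: the remainder is multiplied by the next base and the integer part is split off
    as the digit. *)
Lemma theta_surj t : 0 <= t < 1 -> exists2 m, digits m & theta m = t.
Proof.
move=> ht.
pose r := fix r k := if k is k'.+1
  then (a k')%:R * r k' - (Num.truncn ((a k')%:R * r k'))%:R else t.
have r01 k : 0 <= r k < 1.
  elim: k => //= k /andP[r0 r1].
  have : 0 <= (a k)%:R * r k by rewrite mulr_ge0.
  by move=> /truncn_itv /andP[]; rewrite -natr1; lra.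
pose m k := Num.truncn ((a k)%:R * r k).
have hm : digits m.
  move=> k; have /andP[r0 r1] := r01 k; rewrite -(ltr_nat R).
  apply: (@le_lt_trans _ _ ((a k)%:R * r k)).
    have : 0 <= (a k)%:R * r k by rewrite mulr_ge0.
    by move=> /truncn_itv /andP[].
  by rewrite gtr_pMr // ltr0n.
(* The remainder [r n] measures the error of the truncation at [n]. *)
have E n : t = approx m n + r n / (radix n)%:R.
  elim: n => [|n ->]; first by rewrite approx0 radix0V add0r mulr1.
  rewrite approxS radixS natrM /= -/(m n).
  have := radixR_gt0 n; have : 0 < (a n)%:R :> R by rewrite ltr0n.
  by move=> *; field; rewrite !gt_eqF.
exists m => //; symmetry; apply: theta_uniq => // n.
have /andP[r0 r1] := r01 n; have h := radixR_gt0 n.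
rewrite {1 2}(E n) lerDl divr_ge0 //= lerD2l.
by rewrite ler_pdivrMr // mulVf ?ltW // gt_eqF.
Qed.

(** Both values lie in the interval of length [1 / radix n] fixed by the first [n] digits. *)
Lemma theta_close m m' n : digits m -> digits m' ->
  (forall k, (k < n)%N -> m k = m' k) -> `|theta m - theta m'| <= (radix n)%:R^-1.
Proof.
move=> hm hm' h.
have e : approx m n = approx m' n.
  elim: n h => [|n IH] h; first by rewrite !approx0.
  by rewrite !approxS h // IH // => k kn; apply: h; rewrite ltnW.
have := theta_ge m n hm; have := theta_le m n hm.
have := theta_ge m' n hm'; have := theta_le m' n hm'; rewrite e ler_norml; lra.
Qed.

(* Passing between congruences modulo [radix n] and differences of [theta]: the
   truncation error at [n] is at most [1 / radix n]. *)
Lemma theta_congP m m' : digits m -> digits m' ->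
  (exists C : nat, forall n, exists2 k : int, (`|k| <= C)%N &
    (radix n %| ((mixnum a m n)%:Z + k - (mixnum a m' n)%:Z)%R)%Z) <->
  theta m - theta m' \in [:: -1; 0; 1].
Proof.
move=> hm hm'; set d := theta m - theta m'.
have [t0 t1] : 0 <= theta m <= 1 /\ 0 <= theta m' <= 1 by split; exact: theta01.
have dn n : `|d - (approx m n - approx m' n)| <= (radix n)%:R^-1.
  rewrite ler_norml /d.
  have := theta_ge m n hm; have := theta_le m n hm.
  have := theta_ge m' n hm'; have := theta_le m' n hm'; lra.
split=> [[C hC]|hd]; last first.
  have [z dz] : exists z : int, d = z%:~R.
    by move: hd; rewrite !inE => /or3P[]/eqP->; [exists (-1)|exists 0|exists 1].
  (* The [k] below is [radix n] times the truncation error of [d], hence at most 1 in absolute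
     value. *)
  exists 1%N => n; pose P := radix n.
  pose k : int := (mixnum a m' n)%:Z - (mixnum a m n)%:Z + z * P%:Z.
  exists k; last by apply/dvdzP; exists z; rewrite /k /P; ring.
  have := dn n; have P0 := radixR_gt0 n.
  rewrite -(ler_pM2r P0) mulVf ?gt_eqF // -[X in _ * X](gtr0_norm P0) -normrM.
  suff -> : (d - (approx m n - approx m' n)) * (radix n)%:R = k%:~R.
    by rewrite -intr_norm -[1]/(1%:~R) ler_int; lia.
  rewrite /k /P dz !rmorphD rmorphM rmorphN /= /approx.
  by field; rewrite gt_eqF.
have [//|dN] := boolP (d \in _); exfalso.
(* As [d] lies in [[-1, 1]] and is none of -1, 0, 1, this is its distance to the nearest integer and
   is positive. *)
pose del := Num.min `|d| (1 - `|d|).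
have del0 : 0 < del.
  move: dN; rewrite !inE !negb_or => /and3P[d1 d2 d3].
  rewrite lt_min normr_gt0 d2 subr_gt0 /= ltr_norml.
  by rewrite !lt_neqAle eq_sym d1 d3 /= /d; lra.
(* In [C.+1] the [C] pays for the exponent [k] and the 1 for the truncation error. *)
have [n hn] := radix_small (C.+1)%:R del del0.
have [k kC /dvdzP[w e]] := hC n.
have P0 := radixR_gt0 n.
have eA : approx m n - approx m' n = w%:~R - k%:~R / (radix n)%:R.
  have := congr1 (fun i : int => i%:~R : R) e.
  rewrite rmorphB rmorphD rmorphM /= => e'.
  apply: (mulIf (lt0r_neq0 P0)); rewrite !mulrBl /approx !divfK ?gt_eqF //.
  by rewrite -e'; ring.
have dw : `|d - w%:~R| < del.
  apply: le_lt_trans hn; rewrite -natr1 mulrDl div1r [leRHS]addrC.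
  have -> : d - w%:~R = (d - (approx m n - approx m' n)) - k%:~R / (radix n)%:R.
    by rewrite eA; ring.
  apply: le_trans (ler_normB _ _) _; apply: lerD (dn n) _.
  rewrite normrM normfV (gtr0_norm P0) ler_pM2r ?invr_gt0 //.
  by rewrite -intr_norm -[C%:R]/((C%:Z)%:~R) ler_int; lia.
have {}dw : `|d - w%:~R| < `|d| /\ `|d - w%:~R| < 1 - `|d|.
  by split; apply: lt_le_trans dw _; rewrite ge_min lexx ?orbT.
(* No integer is closer to [d] than [del]; the sign of [w] decides whether -1, 1 or 0 is the integer
   to compare with. *)
have [w0|w0|w0] := ltrgtP w 0.
- have : w%:~R <= -1 :> R by rewrite -[-1]/((-1)%:~R) ler_int -ltzD1.
  case: dw; have := ler_norm (d - w%:~R); have := ler_norm d.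
  by have := ler_norm (- d); rewrite normrN; lra.
- have : 1 <= w%:~R :> R by rewrite -[1]/(1%:~R) ler_int -gtz0_ge1.
  case: dw; have := ler_norm (- (d - w%:~R)); have := ler_norm d; rewrite normrN.
  by have := ler_norm (- d); rewrite normrN; lra.
- by move: dw; rewrite w0 subr0 ltxx => -[].
Qed.

End MixedRadixExpansion.

Lemma radix_shift a n : radix a n.+1 = (a 0 * radix (fun k => a k.+1) n)%N.
Proof. by rewrite /radix big_ord_recl. Qed.

(** Digit 0 is the most significant, so its weight is the product of all other bases. *)
Lemma mixnum_shift a m n : mixnum a m n.+1 =
  (mixnum (fun k => a k.+1) (fun k => m k.+1) n + radix (fun k => a k.+1) n * m 0)%N.
Proof.
elim: n => [|n IH]; first by rewrite /= /radix big_ord0 muln0 mul1n addn0.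
rewrite -[LHS]/(m n.+1 + a n.+1 * mixnum a m n.+1)%N IH radixS /=; lia.
Qed.

(** Multiplication by [a 0] brings digit 0 before the radix point. The right side lies in every
    truncation interval of the shifted digits, so [theta_uniq] applies. *)
Lemma theta_shift (R : realType) (a m : nat -> nat) : (forall k, (0 < a k)%N) ->
  (forall M, exists n, (M < radix (fun k => a k.+1) n)%N) -> digits a m ->
  theta R (fun k => a k.+1) (fun k => m k.+1) =
  ((a 0%N)%:R * theta R a m - (m 0%N)%:R)%R.
Proof.
move=> a0 au hm; symmetry; apply: theta_uniq => // n.
have E : (approx R (fun k => a k.+1) (fun k => m k.+1) n =
    (a 0%N)%:R * approx R a m n.+1 - (m 0%N)%:R)%R.
  have := radixR_gt0 R (fun k => a k.+1) (fun k => a0 k.+1) n.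
  have : (0 < (a 0%N)%:R :> R)%R by rewrite ltr0n.
  rewrite /approx mixnum_shift radix_shift !natrD !natrM => *.
  by field; rewrite !gt_eqF.
have an : (0 < (a 0%N)%:R :> R)%R by rewrite ltr0n.
rewrite E lerD2r ler_pM2l // theta_ge //= addrAC lerD2r.
have -> : ((radix (fun k => a k.+1) n)%:R^-1 = (a 0%N)%:R * (radix a n.+1)%:R^-1 :> R)%R.
  have := radixR_gt0 R (fun k => a k.+1) (fun k => a0 k.+1) n.
  by rewrite radix_shift natrM => *; field; rewrite !gt_eqF.
by rewrite -mulrDr ler_pM2l // theta_le.
Qed.

(** * The circle *)

Section Circle.
Import numFieldNormedType.Exports.
Local Open Scope ring_scope.
Local Notation R := Rdefinitions.R.

Lemma continuous_scale (R : realType) (f : R -> R) (c : R) :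
  continuous f -> continuous (fun t => f (c * t)%R).
Proof.
move=> cf t; apply: (continuous_comp (f := *%R c)); last exact: cf.
exact: mulrl_continuous.
Qed.

Lemma within_cvgrPdist (R : realType) (X : topologicalType) (S : set X) (f : X -> R) :
  (forall x e, S x -> 0 < e -> \forall y \near x, S y -> `|f x - f y| < e) ->
  {within S, continuous f}.
Proof.
move=> h; apply/subspace_continuousP => x Sx; apply/cvgrPdist_lt => e e0.
exact: h.
Qed.

(** The point [exp (2 pi i t)], so that [t] counts full turns. *)
Definition circ (t : R) : Cplx := (trigo.cos (pi *+ 2 * t), sin (pi *+ 2 * t)).

Lemma circle_circ t : circle (circ t).
Proof. exact: trigo.cos2Dsin2. Qed.

Lemma continuous_circ : continuous circ.
Proof.
move=> t; apply: (@cvg_pair _ _ _ (nbhs t) (nbhs (trigo.cos (pi *+ 2 * t)))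
  (nbhs (sin (pi *+ 2 * t))) _ _ _ (fun t => trigo.cos (pi *+ 2 * t))).
  exact: (continuous_scale R trigo.cos _ (@trigo.continuous_cos R)).
exact: (continuous_scale R sin _ (@trigo.continuous_sin R)).
Qed.

Lemma circ_within (X : topologicalType) (S : set X) (f : X -> R) :
  (forall x e, S x -> 0 < e -> \forall y \near x, S y -> `|f x - f y| < e) ->
  {within S, continuous (fun x => circ (f x))}.
Proof.
move=> /within_cvgrPdist cf x; apply: (continuous_comp (cf x)).
exact: continuous_circ.
Qed.

Lemma hausdorff_realType (R : realType) : hausdorff_space R.
Proof. exact: norm_hausdorff. Qed.

Lemma hausdorff_Cplx : hausdorff_space Cplx.
Proof.
move=> [a b] [c d] h; congr (_, _); apply: (hausdorff_realType R) => U V nU nV.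
  have [z [Uz Vz]] : (fst @^-1` U `&` fst @^-1` V : set Cplx) !=set0.
    by apply: h; [exact: (@cvg_fst _ _ _ (nbhs b))|exact: (@cvg_fst _ _ _ (nbhs d))].
  by exists z.1.
have [z [Uz Vz]] : (snd @^-1` U `&` snd @^-1` V : set Cplx) !=set0.
  by apply: h; [exact: (@cvg_snd _ _ (nbhs a))|exact: (@cvg_snd _ _ (nbhs c))].
by exists z.2.
Qed.

Lemma circD s t : circ (s + t) = cmul (circ s) (circ t).
Proof. by rewrite /circ /cmul /= mulrDr trigo.cosD trigo.sinD; congr (_, _); ring. Qed.

Lemma circ_nat n : circ n%:R = (1, 0).
Proof.
elim: n => [|n IH]; first by rewrite /circ mulr0 trigo.cos0 trigo.sin0.
rewrite -natr1 circD IH /circ /cmul /= mulr1 trigo.cos2pi trigo.sin2pi.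
by congr (_, _); ring.
Qed.

Lemma circ_cpow n t : circ (n%:R * t) = cpow (circ t) n.
Proof.
elim: n => [|n IH]; first by rewrite mul0r -[0]/(0%:R) circ_nat.
by rewrite /cpow iterS -/(cpow _ n) -IH -circD -natr1; congr circ; ring.
Qed.

Lemma circDnat t n : circ (t + n%:R) = circ t.
Proof.
by rewrite circD circ_nat /cmul /= !mulr1 !mulr0 subr0 add0r.
Qed.

(** Equal points give [sin (pi * (s - t)) = 0] by the double angle formula; the sine is positive
    strictly between 0 and [pi], and [s - t] lies in [[-1, 1]]. *)
Lemma circ_eqP s t : 0 <= s <= 1 -> 0 <= t <= 1 ->
  circ s = circ t <-> s - t \in [:: -1; 0; 1].
Proof.
move=> hs ht; split=> [[ec es]|].
  have h : trigo.cos (pi *+ 2 * (s - t)) = 1.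
    by rewrite mulrBr trigo.cosB ec es -!expr2 trigo.cos2Dsin2.
  have {}h : sin (pi * (s - t)) = 0.
    apply/eqP; rewrite -sqrf_eq0 trigo.sin2cos2.
    have := trigo.cos_mulr2n (pi * (s - t)).
    by rewrite -mulrnAl h => ?; apply/eqP; lra.
  have pi0 : 0 < pi :> R := pi_gt0 R.
  rewrite !inE; apply/or3P; move: h; set d := s - t => h.
  have [d0|d0|d0] := ltrgtP d 0; last by constructor 2; apply/eqP.
    have [d1|d1] := ltP (-1) d.
      suff : 0 < sin (pi * - d) by rewrite mulrN trigo.sinN h oppr0 ltxx.
      by apply: trigo.sin_gt0_pi; rewrite mulr_gt0 ?oppr_gt0 //= gtr_pMr //; lra.
    by constructor 1; apply/eqP; move: d1; rewrite /d; lra.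
  have [d1|d1] := ltP d 1; last by constructor 3; apply/eqP; move: d1; rewrite /d; lra.
  suff : 0 < sin (pi * d) by rewrite h ltxx.
  by apply: trigo.sin_gt0_pi; rewrite mulr_gt0 //= gtr_pMr.
rewrite !inE => /or3P[]/eqP e.
- by rewrite -(circDnat s 1); congr circ; rewrite mulr1n; lra.
- by congr circ; lra.
- by rewrite -(circDnat t 1); congr circ; rewrite mulr1n; lra.
Qed.

(** The upper half circle is parametrised by [acos x / (2 pi)], the open lower half by one minus
    this. *)
Lemma circ_surj z : circle z -> exists2 t, 0 <= t < 1 & circ t = z.
Proof.
case: z => x y; rewrite /circle /= => e.
have x1 : -1 <= x <= 1.
  by have := sqr_ge0 y; move: e; rewrite !expr2 => e y0; apply/andP; split; nra.
have pi0 : 0 < pi :> R := pi_gt0 R.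
have a0 := trigo.acos_ge0 x1; have a1 := trigo.acos_lepi x1.
have ca : trigo.cos (acos x) = x by apply: trigo.acosK; rewrite in_itv.
have sa : sin (acos x) = `|y|.
  by rewrite trigo.sin_acos // -e addrC addKr sqrtr_sqr.
have p20 : 0 < pi *+ 2 :> R by rewrite mulr2n addr_gt0.
have p2 : pi *+ 2 != 0 :> R by rewrite gt_eqF.
have [y0|y0] := leP 0 y.
  exists (acos x / (pi *+ 2)).
    apply/andP; split; first by rewrite divr_ge0 // ltW.
    by rewrite ltr_pdivrMr // mul1r mulr2n; lra.
  by rewrite /circ mulrC divfK // ca sa ger0_norm.
(* This keeps the parameter strictly below 1: [acos x = 0] would give [y = 0]. *)
have an0 : acos x != 0.
  apply/eqP => a_0; move: sa; rewrite a_0 trigo.sin0 => /esym/eqP.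
  by rewrite normr_eq0 lt_eqF.
exists (1 - acos x / (pi *+ 2)).
  have h : 0 < acos x / (pi *+ 2) by rewrite divr_gt0 // lt_def an0.
  have : acos x / (pi *+ 2) <= 1.
    by rewrite ler_pdivrMr // mul1r mulr2n; lra.
  by lra.
rewrite -[RHS]/(x, y) /circ mulrBr mulr1 [_ * (_ / _)]mulrC divfK //.
rewrite trigo.cosB trigo.sinB trigo.cos2pi trigo.sin2pi ca sa !mul0r !mul1r addr0 add0r.
by rewrite ltr0_norm // opprK.
Qed.

Lemma circle_connected : connected circle.
Proof.
have -> : circle = circ @` `[0, 1].
  apply/seteqP; split=> [z /circ_surj[t /andP[t0 t1] <-]|_ [t _ <-]].
    by exists t => //=; rewrite in_itv /= t0 ltW.
  exact: circle_circ.
apply: connected_continuous_connected; first exact: segment_connected.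
by apply: continuous_subspaceT => t; exact: continuous_circ.
Qed.

End Circle.

(** * Quotients by saturated closed sets *)

Lemma within_closedP (X Y : topologicalType) (S : set X) (f : X -> Y) : closed S ->
  {within S, continuous f} <->
  (forall C : set Y, closed C -> closed (S `&` f @^-1` C)).
Proof.
move=> cS; rewrite continuous_closedP.
by split=> h C cC; have := h C cC; rewrite -closed_setSI.
Qed.

Lemma near_const_within (X : topologicalType) (T : choiceType) (S : set X)
  (f : X -> discrete_topology T) :
  (forall x, S x -> \forall y \near x, S y -> f y = f x) ->
  {within S, continuous f}.
Proof.
move=> h; apply/subspace_continuousP => x Sx; apply/discrete_cvg.
exact: h.
Qed.

Lemma connected_discrete (T : choiceType) (C : set (discrete_topology T)) x y :
  connected C -> C x -> C y -> x = y.
Proof.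
move=> cC Cx Cy; have [] // : [set x] y; rewrite (cC [set x]) //.
- by exists x.
- by exists [set x]; [exact: discrete_open | apply/seteqP; split=> [z ->|z []]].
- by exists [set x]; [exact: discrete_closed | apply/seteqP; split=> [z ->|z []]].
Qed.

Lemma connected_near_const (X : topologicalType) (T : choiceType) (C S : set X)
  (f : X -> discrete_topology T) x y : connected C -> C `<=` S ->
  {within S, continuous f} -> C x -> C y -> f x = f y.
Proof.
move=> cC CS cf Cx Cy; apply: (@connected_discrete T (f @` C)).
- by apply: connected_continuous_connected => //; exact: continuous_subspaceW cf.
- by exists x.
- by exists y.
Qed.

Section SaturatedQuotient.
Local Open Scope quotient_scope.
Variables (T : topologicalType) (Q0 : quotType T) (Y : topologicalType).
Local Notation Q := (quotient_topology Q0).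
Variable Z : set T.
Hypotheses (cZ : closed Z)
  (sZ : forall x y, Z x -> \pi_Q x = \pi_Q y -> Z y).

Lemma saturated_preimage (D : set T) :
  (forall x y, D x -> \pi_Q x = \pi_Q y -> D y) ->
  \pi_Q @^-1` (\pi_Q @` D) = D.
Proof.
move=> sD; apply/seteqP; split=> [x [y Dy e]|x Dx]; last by exists x.
exact: sD Dy e.
Qed.

Lemma quotient_closedP (C : set Q) : closed C <-> closed (\pi_Q @^-1` C : set T).
Proof. by rewrite -!openC preimage_setC. Qed.

Lemma closed_quotient_image : closed (\pi_Q @` Z : set Q).
Proof. by apply/quotient_closedP; rewrite saturated_preimage. Qed.

(** A subset of the quotient is closed when its preimage is; as [Z] is saturated, the set to test
    pulls back to a relative preimage inside [Z]. *)
Lemma quotient_within (f : Q -> Y) : {within Z, continuous (f \o \pi_Q)} ->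
  {within (\pi_Q @` Z : set Q), continuous f}.
Proof.
move=> /within_closedP h; apply/within_closedP; first exact: closed_quotient_image.
move=> C cC; apply/quotient_closedP.
by rewrite preimage_setI saturated_preimage //; exact: h.
Qed.

(** The argument for continuous bijections from compact to Hausdorff spaces: closed subsets of [Z]
    have compact, hence closed, images, and these are the preimages under the inverse. *)
Lemma quotient_homeo (f : Q -> Y) (z0 : T) : compact [set: T] ->
  hausdorff_space Y -> Z z0 -> {within Z, continuous (f \o \pi_Q)} ->
  (forall x y, Z x -> Z y -> f (\pi_Q x) = f (\pi_Q y) -> \pi_Q x = \pi_Q y) ->
  homeo_on f (\pi_Q @` Z : set Q) ((f \o \pi_Q) @` Z).
Proof.
move=> cT hY Zz0 cf finj.
have cZ' : compact Z by exact: subclosed_compact cZ cT _.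
(* A section of [f \o \pi_Q] over its image, with the default value [z0] elsewhere. *)
have /boolp.choice[g hg] y : exists x, ((f \o \pi_Q) @` Z) y -> Z x /\ f (\pi_Q x) = y.
  have [[x Zx e]|n] := pselect (((f \o \pi_Q) @` Z) y); first by exists x.
  by exists z0.
have gf x : Z x -> \pi_Q (g (f (\pi_Q x))) = \pi_Q x.
  move=> Zx; have [|Zg e] := hg (f (\pi_Q x)); first by exists x.
  exact: finj.
exists (fun y => \pi_Q (g y)); split; first split.
- by move=> _ [x Zx <-]; exists x.
- by move=> y /hg [Zg _]; exists (g y).
- by move=> _ [x Zx <-]; rewrite gf.
- by move=> y /hg [].
split; first exact: quotient_within.
have cimg (D : set T) : closed D -> D `<=` Z -> closed ((f \o \pi_Q) @` D).
  move=> cD DZ; apply: (compact_closed hY); apply: continuous_compact.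
    exact: continuous_subspaceW cf.
  exact: subclosed_compact cD cZ' DZ.
apply/within_closedP; first exact: cimg.
move=> C cC; rewrite (_ : _ `&` _ = (f \o \pi_Q) @` (Z `&` \pi_Q @^-1` C)).
  by apply: cimg => [|x []//]; apply: closedI => //; apply/quotient_closedP.
apply/seteqP; split=> [_ [[x Zx <-] Cx]|_ [x [Zx Cx] <-]].
  by exists x => //; split=> //=; move: Cx; rewrite /= gf.
by split; [exists x | rewrite /= gf].
Qed.

End SaturatedQuotient.

(** * The path space *)

Section EinfTopology.
Variables (N : nat) (A : 'M[nat]_N).
Implicit Types (x y z : Einf N A).

Lemma coord_continuous k :
  continuous (fun x : Seq N => x k : discrete_topology (Lbl N)).
Proof. by move=> x; exact: proj_continuous. Qed.

Lemma near_val x k : \forall y \near x, val y k = val x k.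
Proof.
have h := coord_continuous k _ _ (discrete_set1 (val x k : discrete_topology (Lbl N))).
exact: (@initial_continuous (Einf N A) (Seq N) set_val x _ h).
Qed.

Lemma near_val_lt x n : \forall y \near x, forall k, (k < n)%N -> val y k = val x k.
Proof.
elim: n => [|n IH]; first exact: filterE.
have hn := near_val x n; apply: filterS2 IH hn => y h hn k.
by rewrite ltnS leq_eqVlt => /orP[/eqP-> //|/h].
Qed.

Lemma Einf_continuous_within (X : topologicalType) (S : set X) (f : X -> Einf N A) :
  (forall k (p : X), S p -> \forall q \near p, S q -> val (f q) k = val (f p) k) ->
  {within S, continuous f}.
Proof.
move=> h.
apply: (@continuous_comp_initial _ (subspace S) _ (val : Einf N A -> Seq N) f).
apply/subspace_continuousP => x Sx; apply/cvg_sup => k.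
move=> U [_ /= [[W oW <-] Wx] /filterS]; apply.
have := h k x Sx; rewrite /= /within /=; apply: filterS => y hy Sy /=.
by rewrite /proj hy.
Qed.

Lemma hausdorff_Einf : hausdorff_space (Einf N A).
Proof.
move=> x y h; apply: Einf_inj => k.
have [z [/= -> ->]] := h _ _ (near_val x k) (near_val y k); by [].
Qed.

Lemma finite_edges : finite_set [set e : Lbl N | is_edge N A e].
Proof.
pose M := \max_(p : 'I_N * 'I_N) A p.1 p.2.
pose s := [seq (p, m) | p <- enum {: 'I_N * 'I_N}, m <- iota 0 M].
apply: (@sub_finite_set _ _ [set` s]); last exact: finite_seq.
move=> [p m] /= lt_m; apply/allpairsP; exists (p, m); split=> //=; first exact: mem_enum.
rewrite mem_iota /=; apply: leq_trans lt_m _.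
by rewrite /M (bigD1 p) //= leq_maxl.
Qed.

(** The edge set is finite, so the sequences of edges form a compact product, in which composability
    is a closed condition. *)
Lemma compact_Einf : compact [set: Einf N A].
Proof.
have cE : compact [set x : Seq N | forall k, is_edge N A (x k)].
  apply: (@tychonoff _ (fun=> discrete_topology (Lbl N)) (fun=> [set e | is_edge N A e])).
  move=> _; apply: finite_compact; exact: finite_edges.
have cl : closed (is_linf N A).
  rewrite (_ : is_linf N A = \bigcap_k [set x : Seq N | is_edge N A (x k)] `&`
      \bigcap_k [set x : Seq N | ls N (x k.+1) = lr N (x k)]); last first.
    apply/seteqP; split=> [x h|x [h1 h2] k]; last by split; [exact: h1|exact: h2].
    by split=> k _; have [] := h k.
  have pc k (D : set (Lbl N)) : closed ((fun x : Seq N => x k) @^-1` D).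
    exact: (continuous_closedP _).1 (coord_continuous k) D (discrete_closed _).
  apply: closedI; apply: closed_bigI => k _; first exact: (pc k [set e | is_edge N A e]).
  (* Composability at [k] becomes an intersection of implications, one for each value [e] of [x k],
     and each implication a union of two closed sets. *)
  rewrite (_ : [set x | _] =
      \bigcap_(e : Lbl N) [set x : Seq N | x k = e -> ls N (x k.+1) = lr N e]).
    apply: closed_bigI => e _.
    rewrite (_ : [set x | _] = (fun x : Seq N => x k) @^-1` [set f | f <> e] `|`
      (fun x : Seq N => x k.+1) @^-1` [set f | ls N f = lr N e]).
      by apply: closedU; exact: pc.
    apply/seteqP; split=> x /=; last by case.
    by have [->|n] := pselect (x k = e); [right; exact: H | left].
  by apply/seteqP; split=> [x /= e f _ <- //|x h]; exact: h.
have cl' : compact (is_linf N A).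
  by apply: subclosed_compact cl cE _ => x h k; have [] := h k.
(* [insubd] below takes a default path, so the empty space is treated apart. *)
have [[x0]|n0] := pselect (exists x : Einf N A, True); last first.
  have -> : [set: Einf N A] = set0.
    by apply/seteqP; split=> // x _; case: n0; exists x.
  exact: compact0.
move=> _; rewrite (_ : [set: _] = (insubd x0 : Seq N -> Einf N A) @` is_linf N A).
  apply: continuous_compact cl'; apply: Einf_continuous_within => k x Sx.
  have h : \forall y \near x, (y : Seq N) k = x k.
    exact: (coord_continuous k x _ (discrete_set1 (x k : discrete_topology (Lbl N)))).
  apply: filterS h => y e Sy; rewrite !insubdK ?inE //.
apply/seteqP; split=> [x _|//]; exists (val x).
  by case: x => x /= /set_mem.
exact: valKd.
Qed.

End EinfTopology.

(** * Fibres of the limit space *)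

Section LimitSpace.
Variables (N : nat) (A : 'M[nat]_N) (B : 'M[int]_N).
Implicit Types (x y z : Einf N A) (v : SeqC N) (q : J A B).
Local Notation qpi := (qpi N A B).
Local Notation rep q := (repr q : Einf N A).
Local Notation sh := (shiftE N A).

Lemma qpiE x : qpi x = Jpi N A B x.
Proof. by rewrite /Defs.qpi unlock. Qed.

Lemma qpi_eqP x y : qpi x = qpi y <-> ae N A B x y.
Proof.
rewrite !qpiE; split=> [h|h].
  have -> : ae N A B x = ae N A B y by exact: (congr1 (fun S => sval S) h).
  exact: ae_refl.
suff e : ae N A B x = ae N A B y.
  rewrite /Jpi; move: (ex_intro _ x _) (ex_intro _ y _); rewrite e => ? ?.
  by congr exist; exact: Prop_irrelevance.
apply/funext => z; apply/propext; split=> h'.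
  exact: ae_trans (ae_sym _ _ _ _ _ h) h'.
exact: ae_trans h h'.
Qed.

Lemma qpi_repr q : qpi (rep q) = q.
Proof. exact: reprK. Qed.

Lemma ae_repr x : ae N A B (rep (qpi x)) x.
Proof. by apply/qpi_eqP; rewrite qpi_repr. Qed.

Lemma piJ_qpi x : piJ N A B (qpi x) = piE N A x.
Proof. exact: piE_ae (ae_repr x). Qed.

Lemma fiberJE v : fiberJ N A B v = qpi @` fiber N A v.
Proof.
apply/seteqP; split=> [q h|_ [x h <-]]; last by rewrite /fiberJ /= piJ_qpi.
by exists (rep q) => //; exact: qpi_repr.
Qed.

Lemma fiber_saturated v x y : fiber N A v x -> qpi x = qpi y -> fiber N A v y.
Proof. by rewrite /fiber /= => <- /qpi_eqP /piE_ae. Qed.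

(** Around each point of the complement, the cylinder on the first [n] coordinates misses [D]. *)
Lemma closed_locally_constant (D : set (Einf N A)) n :
  (forall x y, (forall k, (k < n)%N -> val x k = val y k) -> D x -> D y) -> closed D.
Proof.
move=> h; rewrite -openC openE => x nD; rewrite /interior /=.
apply: filterS (near_val_lt N A x n) => y e Dy; apply: nD.
exact: h e Dy.
Qed.

Lemma closed_fiber v : closed (fiber N A v).
Proof.
rewrite (_ : fiber N A v = \bigcap_k [set x | piE N A x k = v k]).
  apply: closed_bigI => k _; apply: (closed_locally_constant _ k.+1) => x y e /= <-.
  by rewrite /piE e.
apply/seteqP; split=> [x fx k _|x h]; first by rewrite -(fx : _ = v).
by apply/funext => k; exact: h.
Qed.

Lemma is_linfC_piE x : is_linfC N A (piE N A x).
Proof.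
move=> k; split; first exact: leq_ltn_trans (leq0n _) (Einf_edge N A x k).
by case: x => x /= /set_mem /(_ k)[].
Qed.

Lemma piE_iter_shift x K :
  piE N A (iter K sh x) = iter K (@shiftC N) (piE N A x).
Proof.
elim: K => //= K <-; apply/funext => k.
by rewrite /shiftC /piE val_shiftE.
Qed.

Lemma iter_shiftC v K k : iter K (@shiftC N) v k = v (k + K)%N.
Proof. by elim: K k => [|K IH] k /=; rewrite ?addn0 // /shiftC IH addnS. Qed.

Lemma is_linfC_iter v K : is_linfC N A v -> is_linfC N A (iter K (@shiftC N) v).
Proof. by move=> h k; rewrite !iter_shiftC; exact: (h (k + K)%N). Qed.

Lemma fiber_iter v x K :
  fiber N A v x -> fiber N A (iter K (@shiftC N) v) (iter K sh x).
Proof. by rewrite /fiber /= piE_iter_shift => ->. Qed.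

Lemma K_is_iter v K : K_is N B v K -> K_is N B (iter K (@shiftC N) v) 0.
Proof.
by move=> [h _]; split=> // k _; rewrite /Bv iter_shiftC; apply: h; rewrite leq_addl.
Qed.

Lemma K_is_uniq v K L : K_is N B v K -> K_is N B v L -> K = L.
Proof.
have aux K' L' : K_is N B v K' -> K_is N B v L' -> (K' <= L')%N.
  move=> [_ h] [h' _]; rewrite leqNgt; apply/negP => lt.
  apply: (h' K'.-1); first by lia.
  by apply: h; lia.
by move=> h h'; apply/eqP; rewrite eqn_leq !aux.
Qed.

(** If the zeros of [B] along [v] stop, [K] is the least index from which on there are none;
    minimality puts a zero at [K.-1]. *)
Lemma K_dichotomy v : K_infinite N B v \/ exists K, K_is N B v K.
Proof.
have [h|/existsNP[n hn]] := pselect (K_infinite N B v); [by left | right].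
have ex : exists K, `[< forall k, (K <= k)%N -> Bv N B v k <> 0%R >].
  by exists n; apply/asboolP => k nk e; apply: hn; exists k.
case: (ex_minnP ex) => K /asboolP hK minK; exists K; split=> // K0.
apply: contrapT => e; have /minK : `[< forall k, (K.-1 <= k)%N -> Bv N B v k <> 0%R >].
  apply/asboolP => k; rewrite leq_eqVlt => /orP[/eqP<- //|lt]; apply: hK; lia.
lia.
Qed.

(** The last zero sits at index [K.-1], where [ae_zero] cuts both paths; for [K = 0] there is
    nothing to cut. *)
Lemma ae_K v K x y : K_is N B v K -> fiber N A v x -> fiber N A v y ->
  ae N A B x y <->
  ae N A B (iter K sh x) (iter K sh y) /\ word N (val x) K = word N (val y) K.
Proof.
case: K => [|K] [_ hK] fx fy; first by split=> [|[]].
by apply: ae_zero; rewrite (fx : piE _ _ _ = _) ?(fy : piE _ _ _ = _) // hK.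
Qed.

Section Path.
Variables (v : SeqC N) (m : nat -> nat).
Hypotheses (hv : is_linfC N A v) (hm : digits (base N A v) m).

Lemma path_of_digits_subproof : is_linf N A (fun k => (v k, m k)).
Proof. by move=> k; split; [exact: hm | have [] := hv k]. Qed.

Definition path_of_digits : Einf N A := 
  exist (fun x : Seq N => x \in is_linf N A) _ (mem_set path_of_digits_subproof).

Lemma fiber_path_of_digits : fiber N A v path_of_digits.
Proof. by apply/funext => k; rewrite /piE /lr /ls /=; case: (v k). Qed.

End Path.

Lemma base_gt0 v : is_linfC N A v -> forall k, (0 < base N A v k)%N.
Proof. by move=> h k; have [] := h k. Qed.

Lemma fiber_nonempty v : is_linfC N A v -> exists x, fiber N A v x.
Proof.
move=> hv; exists (path_of_digits v (fun=> 0%N) hv (base_gt0 v hv)).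
exact: fiber_path_of_digits.
Qed.

Definition angle x : Rdefinitions.R :=
  theta Rdefinitions.R (base N A (piE N A x)) (dig N A x).

Lemma digits_dig v x : fiber N A v x -> digits (base N A v) (dig N A x).
Proof. by move=> <- k; exact: dig_lt. Qed.

Lemma unbounded_radix v : Aprod_unbounded N A v ->
  forall M, exists n, (M < radix (base N A v) n)%N.
Proof. by move=> h M; have [n [_ lt]] := h M; exists n. Qed.

Hypothesis HB01 : forall i j, B i j = 0%R \/ B i j = 1%R.

Lemma Bv_eq1 v : K_is N B v 0 -> forall k, Bv N B v k = 1%R.
Proof.
move=> [h _] k; have := h k (leq0n k); rewrite /Bv.
by case: (HB01 (v k).1 (v k).2) => ->.
Qed.

Lemma ae_angle v x y : K_is N B v 0 -> Aprod_unbounded N A v ->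
  fiber N A v x -> fiber N A v y ->
  ae N A B x y <-> circ (angle x) = circ (angle y).
Proof.
move=> hK hu fx fy.
have hv : is_linfC N A v by rewrite -(fx : _ = v); exact: is_linfC_piE.
have exy : piE N A x = piE N A y by rewrite (fx : _ = v) (fy : _ = v).
have dx := digits_dig _ _ fx; have dy := digits_dig _ _ fy.
have b0 := base_gt0 v hv; have bu := unbounded_radix v hu.
rewrite ae_numP //; last by rewrite (fx : _ = v); exact: Bv_eq1.
rewrite circ_eqP /angle -?exy (fx : _ = v); [|exact: theta01..].
exact: theta_congP.
Qed.

Lemma angle_shift v x : is_linfC N A v -> Aprod_unbounded N A v -> fiber N A v x ->
  angle (sh x) = ((base N A v 0)%:R * angle x - (dig N A x 0)%:R)%R.
Proof.
move=> hv hu fx; rewrite /angle (fx : _ = v) -theta_shift; first last.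
- exact: digits_dig.
(* The bound [base 0 * M] allows for division by the first base. The empty product exceeds it only
   for [M = 0]. *)
- move=> M; have [n h] := unbounded_radix v hu (base N A v 0 * M)%N.
  have := h; case: n {h} => [|n]; last first.
    by rewrite radix_shift ltn_pmul2l ?base_gt0 // => ?; exists n.
  rewrite /radix big_ord0 ltnS leqn0 muln_eq0 gtn_eqF ?base_gt0 //= => /eqP->.
  by exists 0%N; rewrite big_ord0.
- exact: base_gt0.
have -> : piE N A (sh x) = fun k => v k.+1.
  by apply/funext => k; rewrite (piE_iter_shift x 1) (fx : _ = v).
by congr theta; apply/funext => k; rewrite /dig val_shiftE.
Qed.

Lemma Aprod_unbounded_shift v : is_linfC N A v -> Aprod_unbounded N A v ->
  Aprod_unbounded N A (shiftC N v).
Proof.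
(* The extra summand [base 0] excludes [n = 1], where the shifted product would be empty. *)
move=> hv hu M; have [[|[|n]] [//]] := hu (base N A v 0 * M + base N A v 0)%N.
  rewrite -[Aprod _ _ _ _]/(radix (base N A v) 1) /radix big_ord1 => _.
  by rewrite ltnNge leq_addl.
rewrite -[Aprod _ _ _ _]/(radix (base N A v) n.+2) radix_shift => _ lt.
exists n.+1; split=> //; have b0 := base_gt0 v hv 0.
have : (base N A v 0 * M < base N A v 0 * radix (fun k => base N A v k.+1) n.+1)%N by lia.
by rewrite ltn_pmul2l.
Qed.

Definition tail_angle K x : Cplx := circ (angle (iter K sh x)).

(** Agreement on [n + K] edges gives the [K]-fold shifts the same first [n] digits, so the angles
    differ by at most [1 / radix n]. *)
Lemma tail_angle_within v K :
  is_linfC N A v -> Aprod_unbounded N A (iter K (@shiftC N) v) ->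
  {within fiber N A v, continuous (tail_angle K)}.
Proof.
move=> hv hu; set w := iter K _ v in hu *.
have hw : is_linfC N A w by exact: is_linfC_iter.
apply: circ_within => x e fx e0.
have [n] := radix_small _ _ (base_gt0 w hw) (unbounded_radix w hu) 1%R e e0.
rewrite div1r => ne.
have h := near_val_lt N A x (n + K)%N.
apply: filterS h => y exy fy; apply: le_lt_trans ne.
have [fx' fy'] := (fiber_iter _ _ K fx, fiber_iter _ _ K fy).
rewrite /angle (fx' : _ = w) (fy' : _ = w).
apply: theta_close; [exact: base_gt0|exact: digits_dig|exact: digits_dig|].
by move=> k kn; rewrite /dig !val_iter_shiftE exy // ltn_add2r.
Qed.

End LimitSpace.

(** * Circles, points and products as fibres; connected components *)

Section Fibres.
Variables (N : nat) (A : 'M[nat]_N) (B : 'M[int]_N).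
Hypothesis HB01 : forall i j, B i j = 0%R \/ B i j = 1%R.
Implicit Types (x y z : Einf N A) (v : SeqC N) (q : J A B).
Local Notation qpi := (qpi N A B).
Local Notation rep q := (repr q : Einf N A).
Local Notation sh := (shiftE N A).

(** For [K = K(v)], the slice of the fibre over one point of [P_v], given by the last [K] edges of
    [x0]. *)
Definition block v K x0 : set (Einf N A) :=
  [set x | fiber N A v x /\ word N (val x) K = word N (val x0) K].

Lemma closed_block v K x0 : closed (block v K x0).
Proof.
rewrite (_ : block v K x0 =
    fiber N A v `&` [set x | word N (val x) K = word N (val x0) K]) //.
apply: closedI; first exact: closed_fiber.
apply: (closed_locally_constant _ _ _ K) => x y e /= <-; apply/eq_wordP => k kK.
by rewrite e.
Qed.

Lemma block0 v x0 : block v 0 x0 = fiber N A v.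
Proof. by apply/seteqP; split=> [x []|x]. Qed.

Lemma block_saturated v K x0 x y : K_is N B v K ->
  block v K x0 x -> qpi x = qpi y -> block v K x0 y.
Proof.
move=> hK [fx wx] exy; have fy := fiber_saturated _ _ _ _ _ _ fx exy.
split=> //; move/qpi_eqP: exy => /(ae_K _ _ _ v K _ _ hK fx fy)[_ <-].
exact: wx.
Qed.

Lemma block_qpi_eqP v K x0 x y : K_is N B v K ->
  Aprod_unbounded N A (iter K (@shiftC N) v) -> block v K x0 x -> block v K x0 y ->
  qpi x = qpi y <-> tail_angle N A K x = tail_angle N A K y.
Proof.
move=> hK hu [fx wx] [fy wy].
rewrite qpi_eqP (ae_K _ _ _ v K) // /tail_angle.
rewrite -(ae_angle _ _ _ HB01 _ _ _ (K_is_iter _ _ _ _ hK) hu); last first.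
- exact: fiber_iter.
- exact: fiber_iter.
by rewrite wx wy; split=> [[]|].
Qed.

Lemma tail_angle_block v K x0 : is_linfC N A v -> K_is N B v K ->
  Aprod_unbounded N A (iter K (@shiftC N) v) -> fiber N A v x0 ->
  tail_angle N A K @` block v K x0 = circle.
Proof.
move=> hv hK hu fx0; set w := iter K _ v in hu *.
have hw : is_linfC N A w by exact: is_linfC_iter.
apply/seteqP; split=> [_ [x _ <-]|z /circ_surj[t t01 <-]]; first exact: circle_circ.
have [m hm <-] := theta_surj _ _ (base_gt0 _ _ w hw) (unbounded_radix _ _ w hu) t t01.
(* The last [K] labels come from [x0], and the tail carries the expansion of [t]. *)
pose m' k := if (k < K)%N then dig N A x0 k else m (k - K)%N.
have hm' : digits (base N A v) m'.
  move=> k; rewrite /m'; case: (ltnP k K) => [_|/subnK e].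
    exact: (digits_dig N A v x0 fx0 k).
  by have := hm (k - K)%N; rewrite /base /w iter_shiftC e.
have fx := fiber_path_of_digits _ _ v m' hv hm'.
set x := path_of_digits _ _ v m' hv hm' in fx.
have dx : dig N A x = m' by [].
exists x.
  split=> //; apply/eq_wordP => k kK; apply: (Einf_dig_inj N A).
    by rewrite (fx : _ = v) (fx0 : _ = v).
  by rewrite dx /m' kK.
have fx' := fiber_iter _ _ _ _ K fx.
rewrite /tail_angle /angle (fx' : _ = w); congr circ; congr theta.
apply/funext => k; rewrite /dig val_iter_shiftE -/(dig N A x (k + K)) dx /m'.
by rewrite ltnNge leq_addl /= addnK.
Qed.

Lemma fiber_repr v x : fiber N A v x -> fiber N A v (rep (qpi x)).
Proof. by move=> fx; apply: (fiber_saturated N A B _ x); rewrite ?qpi_repr. Qed.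

(** Maps on the limit space are defined through [repr]; where the value does not depend on the
    representative, they are handled as maps on paths. *)
Lemma repr_within (Y : topologicalType) (Z : set (Einf N A)) (f g : Einf N A -> Y) :
  (forall x, Z x -> f (rep (qpi x)) = g x) ->
  {within Z, continuous g} -> {within Z, continuous ((fun q => f (rep q)) \o qpi)}.
Proof.
by move=> e; apply: subspace_eq_continuous => x; rewrite inE => /e.
Qed.

Lemma block_repr v K x0 x : K_is N B v K -> block v K x0 x ->
  block v K x0 (rep (qpi x)).
Proof. by move=> hK /(block_saturated _ _ _ _ _ hK); apply; rewrite qpi_repr. Qed.

Lemma block_homeo v K x0 : is_linfC N A v -> K_is N B v K ->
  Aprod_unbounded N A (iter K (@shiftC N) v) -> fiber N A v x0 ->
  homeo_on (fun q => tail_angle N A K (rep q)) (qpi @` block v K x0) circle.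
Proof.
move=> hv hK hu fx0.
have e x : block v K x0 x -> tail_angle N A K (rep (qpi x)) = tail_angle N A K x.
  move=> bx; apply/(block_qpi_eqP v K x0 _ _ hK hu) => //; first exact: block_repr.
  by rewrite qpi_repr.
have := quotient_homeo _ (Jcls N A B) _ _ (closed_block v K x0)
  (fun x y => block_saturated v K x0 x y hK) (fun q => tail_angle N A K (rep q)) x0
  (compact_Einf N A).
rewrite (_ : (_ \o _) @` _ = circle); last first.
  rewrite -(tail_angle_block v K x0 hv hK hu fx0).
  by apply/seteqP; split=> _ [x bx <-]; exists x => //=; rewrite ?e //; rewrite -e.
apply=> //.
- exact: hausdorff_Cplx.
- apply: (repr_within _ _ _ _ e).
  apply: (continuous_subspaceW _ (tail_angle_within _ _ _ _ hv hu)).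
  by move=> x [].
- move=> x y bx bY /=; rewrite !e // => h.
  exact/(block_qpi_eqP v K x0 x y hK hu bx bY).
Qed.

Lemma bounded_block v K x0 x y : K_is N B v K ->
  ~ Aprod_unbounded N A (iter K (@shiftC N) v) -> block v K x0 x -> block v K x0 y ->
  qpi x = qpi y.
Proof.
move=> hK hu [fx wx] [fy wy]; apply/qpi_eqP/(ae_K _ _ _ v K _ _ hK fx fy).
split; last by rewrite wx wy.
have [fx' fy'] := (fiber_iter _ _ _ _ K fx, fiber_iter _ _ _ _ K fy).
apply: ae_bounded.
- by rewrite (fx' : _ = _) (fy' : _ = _).
- by rewrite (fx' : _ = _); apply: Bv_eq1 => //; exact: K_is_iter.
- by rewrite (fx' : _ = _).
Qed.

Lemma repr_K_infinite v x : K_infinite N B v -> fiber N A v x -> rep (qpi x) = x.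
Proof.
move=> hK fx; apply: ae_K_infinite (ae_repr _ _ _ _).
by rewrite (piE_ae _ _ _ _ _ (ae_repr _ _ _ _)) (fx : _ = v).
Qed.

Lemma K_infinite_homeo v : is_linfC N A v -> K_infinite N B v ->
  homeo_on (fun q => rep q) (fiberJ N A B v) (fiber N A v).
Proof.
move=> hv hK; have [x0 fx0] := fiber_nonempty _ _ v hv; rewrite fiberJE.
have e x : fiber N A v x -> rep (qpi x) = x by exact: repr_K_infinite.
have := quotient_homeo _ (Jcls N A B) (Einf N A) _ (closed_fiber N A v)
  (fiber_saturated N A B v) (fun q => rep q) x0 (compact_Einf N A)
  (hausdorff_Einf N A) fx0.
rewrite (_ : (_ \o _) @` _ = fiber N A v); last first.
  apply/seteqP; split=> [_ [x fx <-]|x fx]; first by rewrite /= e.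
  by exists x => //=; rewrite e.
apply.
- apply: (repr_within (Einf N A) _ id id e); apply: Einf_continuous_within => k p _.
  by apply: filterS (near_val N A p k) => y ->.
- by move=> x y fx fy /=; rewrite !e // => ->.
Qed.

(** Whether the edge of index [k] differs from a given one depends on [k.+1] coordinates of a path,
    so it is a closed condition on paths. *)
Lemma near_piJ q k : \forall q' \near q, piJ N A B q' k = piJ N A B q k.
Proof.
apply: open_nbhs_nbhs; split=> //; rewrite -closedC; apply/quotient_closedP.
apply: (closed_locally_constant _ _ _ k.+1) => x y e.
change (~ (piJ N A B (qpi x) k = piJ N A B q k) ->
        ~ (piJ N A B (qpi y) k = piJ N A B q k)).
by rewrite !piJ_qpi /piE e.
Qed.

Lemma connected_sub_fiberJ (C : set (J A B)) q : connected C -> C q ->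
  C `<=` fiberJ N A B (piJ N A B q).
Proof.
move=> cC Cq q' Cq'; apply/funext => k.
apply: (connected_near_const _ _ C setT (fun p => piJ N A B p k)) => //.
by apply: near_const_within => p _; apply: filterS (near_piJ p k).
Qed.

Lemma word_within v K : K_is N B v K ->
  {within fiberJ N A B v,
    continuous (fun q => word N (val (rep q)) K : discrete_topology (seq (Lbl N)))}.
Proof.
move=> hK; rewrite fiberJE; apply: (quotient_within _ _ _ _ (closed_fiber N A v)
  (fiber_saturated N A B v)).
apply: (repr_within (discrete_topology (seq (Lbl N))) _
  (fun x => word N (val x) K) (fun x => word N (val x) K)).
  move=> x fx; have fx' := fiber_repr v x fx.
  by have [] := (ae_K _ _ _ v K _ _ hK fx' fx).1 (ae_repr _ _ _ _).
apply: near_const_within => x _; apply: filterS (near_val_lt N A x K) => y h _.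
exact/eq_wordP.
Qed.

(** A component lies in a fibre and, for finite [K(v)], in the image of a block, since edges in E_C
    and the last [K] edges are locally constant. That image is a point or a circle, hence connected
    and the whole component. *)
Lemma component_point_or_circle q :
  connected_component setT q = [set q] \/
  exists h : J A B -> Cplx, homeo_on h (connected_component setT q) circle.
Proof.
set C := connected_component _ _.
have cC : connected C by exact: component_connected.
have Cq : C q by exact: connected_component_refl.
have Cf := connected_sub_fiberJ C q cC Cq.
have point : (forall q', C q' -> q' = q) -> C = [set q].
  by move=> h; apply/seteqP; split=> [q' /h //|_ ->].
set v := piJ N A B q in Cf.
have hv : is_linfC N A v by exact: is_linfC_piE.
have [hK|[K hK]] := K_dichotomy N B v.
  left; apply: point => q' Cq'.
  rewrite -(qpi_repr _ _ _ q) -(qpi_repr _ _ _ q'); congr Defs.qpi.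
  (* The image of the component under [repr] is connected in the path space, where every coordinate
     is locally constant. *)
  apply: Einf_inj => k.
  have [g [_ [ch _]]] := K_infinite_homeo v hv hK.
  apply: (connected_near_const _ _ (repr @` C) setT (fun x => val x k)); last 2 first.
  - by exists q'.
  - by exists q.
  - apply: connected_continuous_connected => //.
    exact: continuous_subspaceW ch.
  - by [].
  - by apply: near_const_within => x _; apply: filterS (near_val N A x k) => y ->.
have CB : C `<=` qpi @` block v K (rep q).
  move=> q' Cq'; exists (rep q'); last exact: qpi_repr.
  split; first exact: Cf.
  exact: (connected_near_const _ _ C _ _ _ _ cC Cf (word_within v K hK)).
have [hu|hu] := pselect (Aprod_unbounded N A (iter K (@shiftC N) v)); last first.
  left; apply: point => q' /CB[x bx <-].
  rewrite -[RHS](qpi_repr _ _ _ q).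
  by apply: (bounded_block v K (rep q)) => //; split.
right; exists (fun q => tail_angle N A K (rep q)).
have hb := block_homeo v K (rep q) hv hK hu erefl.
suff -> : C = qpi @` block v K (rep q) by [].
(* As a continuous image of the circle, the right side is connected and so inside the component. *)
apply/seteqP; split=> //; apply: connected_component_max => //.
  by exists (rep q); [split | exact: qpi_repr].
have [g [[h1 h2 h3 h4] [_ cg]]] := hb.
rewrite (_ : _ @` _ = g @` circle).
  by apply: connected_continuous_connected cg; exact: circle_connected.
apply/seteqP; split=> [p bp|_ [z /h2 ? <-] //].
by exists (tail_angle N A K (rep p)); [exact: h1 | exact: h3].
Qed.

Lemma fiberJ_point v : is_linfC N A v -> K_is N B v 0 -> ~ Aprod_unbounded N A v ->
  exists q, fiberJ N A B v = [set q].
Proof.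
move=> hv hK hu; have [x0 fx0] := fiber_nonempty _ _ v hv.
exists (qpi x0); rewrite fiberJE -(block0 v x0).
apply/seteqP; split=> [_ [x bx <-]|_ ->]; last by exists x0.
exact: (bounded_block v 0 x0).
Qed.

Lemma sigmaJE q : sigmaJ N A B q = qpi (sh (rep q)).
Proof. by []. Qed.

Lemma fiber_shift v x : fiber N A v x -> fiber N A (shiftC N v) (sh x).
Proof. exact: (fiber_iter N A v x 1). Qed.

Lemma tail_angle_sigmaJ v q : is_linfC N A v -> K_is N B v 0 ->
  Aprod_unbounded N A v -> fiberJ N A B v q ->
  tail_angle N A 0 (rep (sigmaJ N A B q)) =
  cpow (tail_angle N A 0 (rep q)) (A (v 0%N).1 (v 0%N).2).
Proof.
move=> hv hK hu fq; set x := rep q; have fx : fiber N A v x by [].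
have hK' : K_is N B (shiftC N v) 0 by split=> // k _; exact: (hK.1 k.+1).
have hu' := Aprod_unbounded_shift N A v hv hu.
have bx : block (shiftC N v) 0 (sh x) (sh x) by split=> //; exact: fiber_shift.
have -> : tail_angle N A 0 (rep (sigmaJ N A B q)) = tail_angle N A 0 (sh x).
  apply/(block_qpi_eqP (shiftC N v) 0 (sh x) _ _ hK' hu') => //.
    exact: block_repr.
  by rewrite qpi_repr.
(* The shift multiplies the angle by the base and subtracts an integer label, which [circ]
   forgets. *)
rewrite /tail_angle /= (angle_shift N A v) // -circ_cpow.
by rewrite -(circDnat _ (dig N A x 0)) subrK.
Qed.

(** One map for all fibres: [K] is recovered from the point itself. If [K] is infinite, [(q, [::])]
    is a default. *)
Definition split_tail q : (J A B * discrete_topology (seq (Lbl N)))%type :=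
  if pselect (exists K, K_is N B (piJ N A B q) K) is left h
  then (qpi (iter (projT1 (cid h)) sh (rep q)), word N (val (rep q)) (projT1 (cid h)))
  else (q, [::]).

Lemma split_tail_repr v K q : K_is N B v K -> fiberJ N A B v q ->
  split_tail q = (qpi (iter K sh (rep q)), word N (val (rep q)) K).
Proof.
move=> hK fq; rewrite /split_tail (fq : _ = v).
case: pselect => [h|[]]; last by exists K.
by case: cid => L hL /=; rewrite (K_is_uniq N B v L K hL hK).
Qed.

Lemma split_tail_qpi v K x : K_is N B v K -> fiber N A v x ->
  split_tail (qpi x) = (qpi (iter K sh x), word N (val x) K).
Proof.
move=> hK fx; have fx' := fiber_repr v x fx.
rewrite (split_tail_repr v K) //.
have [/qpi_eqP -> ->] := (ae_K _ _ _ v K _ _ hK fx' fx).1 (ae_repr _ _ _ _).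
by [].
Qed.

Lemma split_tail_sigmaJ v K q : K_is N B v K -> (0 < K)%N -> fiberJ N A B v q ->
  split_tail (sigmaJ N A B q) = ((split_tail q).1, dropLast N (split_tail q).2).
Proof.
case: K => // K hK _ fq.
(* The last zero moves one place closer, so one shift fewer is left and the first component stays
   the same. *)
have hK' : K_is N B (shiftC N v) K.
  case: hK => h1 h2; split=> [k Kk|]; first exact: (h1 k.+1).
  by case: (K) h2 => // n h2 _; exact: h2.
rewrite sigmaJE (split_tail_qpi _ K _ hK' (fiber_shift _ _ fq)).
rewrite (split_tail_repr _ _ _ hK fq) -iterSr /=; congr (_, _).
(* [word] lists the largest index first, so its last letter is the edge of index 0 that the shift
   removes. *)
rewrite /dropLast size_word /= -addn1 wordD take_size_cat ?size_word //.
by congr word; apply/funext => k; rewrite val_shiftE addn1.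
Qed.

Lemma nth_word d (f : nat -> Lbl N) K t :
  (t < K)%N -> nth d (word N f K) t = f (K - t.+1)%N.
Proof.
move=> tK; rewrite /word nth_rev ?size_mkseq // nth_mkseq //; lia.
Qed.

Lemma Pv_word v K x : fiber N A v x -> Pv N A v K (word N (val x) K).
Proof.
move=> fx; split; first exact: size_word.
move=> t tK /=; rewrite nth_word //; split; first exact: Einf_edge.
by rewrite -(fx : _ = v) /piE subnAC subn1 subnS.
Qed.

(* [insubd] makes [glue] total; its value is [y] when the pieces do not fit. *)
Definition glue v K y (s : seq (Lbl N)) : Einf N A :=
  insubd y ((fun k => if (k < K)%N then nth ((v 0%N).1, (v 0%N).2, 0%N) s (K - 1 - k)
                      else val y (k - K)%N) : Seq N).

Section Glue.
Variables (v : SeqC N) (K : nat) (y : Einf N A) (s : seq (Lbl N)).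
Hypotheses (hv : is_linfC N A v) (fy : fiber N A (iter K (@shiftC N) v) y)
  (hs : Pv N A v K s).

(** Both pieces lie over [v], whose consecutive edges are composable, so the glued sequence is a
    path and [insubd] does not fall back on its default. *)
Lemma val_glue k : val (glue v K y s) k =
  if (k < K)%N then nth ((v 0%N).1, (v 0%N).2, 0%N) s (K - 1 - k) else val y (k - K)%N.
Proof.
rewrite /glue insubdK // inE; set f := (f in is_linf _ _ f).
have h l : is_edge N A (f l) /\ (lr N (f l), ls N (f l)) = v l.
  rewrite /f; case: (ltnP l K) => [lK|Kl].
    have [|e1 e2] := hs.2 (K - 1 - l)%N; first lia.
    split; first exact: e1.
    by rewrite e2; congr v; lia.
  split; first exact: Einf_edge.
  have := congr1 (@^~ (l - K)%N) (fy : piE _ _ _ = _); rewrite /piE iter_shiftC => ->.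
  by rewrite subnK.
move=> l; split; first exact: (h l).1.
have := (h l.+1).2; have := (h l).2 => e1 e2.
have [_] := hv l; rewrite -[v l.+1]e2 -[v l]e1; exact.
Qed.

Lemma shift_glue : iter K sh (glue v K y s) = y.
Proof.
apply: Einf_inj => k; rewrite val_iter_shiftE val_glue ltnNge leq_addl /=.
by rewrite addnK.
Qed.

Lemma word_glue : word N (val (glue v K y s)) K = s.
Proof.
apply: (@eq_from_nth _ ((v 0%N).1, (v 0%N).2, 0%N)).
  by rewrite size_word; case: hs.
move=> t; rewrite size_word => tK; rewrite nth_word // val_glue.
have -> : (K - t.+1 < K)%N by lia.
congr nth; lia.
Qed.

Lemma fiber_glue : fiber N A v (glue v K y s).
Proof.
apply/funext => k; have [kK|Kk] := ltnP k K; last first.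
  rewrite -(subnK Kk) -piE_shift shift_glue (fy : piE _ _ _ = _) iter_shiftC.
  by [].
rewrite /piE val_glue kK; have [|_ e2] := hs.2 (K - 1 - k)%N; first lia.
by rewrite e2; congr v; lia.
Qed.

End Glue.

(** The inverse glues a representative of the tail class to the finite path [s]; by [ae_K] the
    resulting class depends on the tail class and [s] alone. *)
Lemma split_tail_homeo v K : is_linfC N A v -> K_is N B v K ->
  homeo_on split_tail (fiberJ N A B v)
    (fiberJ N A B (iter K (@shiftC N) v) `*` Pv N A v K).
Proof.
move=> hv hK; set w := iter K _ v.
have repw q : fiberJ N A B w q -> fiber N A w (rep q) by [].
exists (fun p => qpi (glue v K (rep p.1) p.2)); split; first split.
- rewrite fiberJE => _ [x fx <-]; rewrite (split_tail_qpi v K) //=; split=> /=.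
    by rewrite fiberJE; exists (iter K sh x) => //; exact: fiber_iter.
  exact: Pv_word.
- move=> [q s] [/= fq hs]; rewrite fiberJE; eexists; last reflexivity.
  exact: fiber_glue.
- rewrite fiberJE => _ [x fx <-]; rewrite (split_tail_qpi v K) //=.
  have hs := Pv_word v K x fx.
  have fr : fiber N A w (rep (qpi (iter K sh x))).
    by apply: fiber_repr; exact: fiber_iter.
  apply/qpi_eqP/(ae_K _ _ _ v K) => //; first exact: fiber_glue.
  rewrite shift_glue ?word_glue //; split=> //; exact: ae_repr.
- move=> [q s] [/= fq hs]; rewrite (split_tail_qpi v K) //; last exact: fiber_glue.
  by rewrite shift_glue ?word_glue // qpi_repr.
split.
  rewrite fiberJE; apply: (quotient_within _ _ _ _ (closed_fiber N A v)
    (fiber_saturated N A B v)).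
  have cs : {within fiber N A v, continuous (iter K sh)}.
    apply: Einf_continuous_within => k p _.
    apply: filterS (near_val N A p (k + K)) => y e _.
    by rewrite !val_iter_shiftE.
  have cw : {within fiber N A v,
      continuous (fun x => word N (val x) K : discrete_topology (seq (Lbl N)))}.
    apply: near_const_within => x _; apply: filterS (near_val_lt N A x K) => y h _.
    exact/eq_wordP.
  apply: (@subspace_eq_continuous _ (fiber N A v)
    (J A B * discrete_topology (seq (Lbl N)))%type
    (fun x => (qpi (iter K sh x), word N (val x) K))).
    by move=> x; rewrite inE => fx /=; rewrite -(split_tail_qpi v K).
  have cq : {within fiber N A v, continuous (fun x => qpi (iter K sh x))}.
    by move=> x; apply: (continuous_comp (cs x)); exact: pi_continuous.
  apply/subspace_continuousP => x fx.
  apply: (@cvg_pair _ _ _ (within (fiber N A v) (nbhs x)) (nbhs (qpi (iter K sh x)))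
    (nbhs (word N (val x) K : discrete_topology (seq (Lbl N)))) _ _ _
    (fun x => qpi (iter K sh x))).
    by move/subspace_continuousP: cq; exact.
  by move/subspace_continuousP: cw; exact.
(* The second factor is discrete, so continuity of the inverse is checked with [s] fixed. *)
apply/subspace_continuousP => -[q s] [/= fq hs].
have cg : {within fiberJ N A B w, continuous (fun q => qpi (glue v K (rep q) s))}.
  rewrite fiberJE; apply: (quotient_within _ _ _ _ (closed_fiber N A w)
    (fiber_saturated N A B w)).
  apply: (repr_within _ _ (fun y => qpi (glue v K y s)) (fun y => qpi (glue v K y s))).
    move=> y fy; have fy' := fiber_repr w y fy.
    apply/qpi_eqP/(ae_K _ _ _ v K) => //; try exact: fiber_glue.
    by rewrite !shift_glue ?word_glue //; split=> //; exact: ae_repr.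
  have cgl : {within fiber N A w, continuous (fun y => glue v K y s)}.
    apply: Einf_continuous_within => k p fp.
    apply: filterS (near_val N A p (k - K)) => y e fy.
    by rewrite !val_glue // e.
  by move=> y; apply: (continuous_comp (cgl y)); exact: pi_continuous.
move/subspace_continuousP: cg => /(_ q fq) cg U /cg hU.
exists ([set p | fiberJ N A B w p -> U (qpi (glue v K (rep p) s))], [set s]).
  by split; [exact: hU | exact: discrete_set1].
by move=> [p t] [/= hp ->] [fp _]; exact: hp.
Qed.

End Fibres.

Theorem theorem6p1 (N : nat) (A : 'M[nat]_N) (B : 'M[int]_N)
  (HAB : forall i j, A i j = 0%N -> B i j = 0%R)
  (HB01 : forall i j, B i j = 0%R \/ B i j = 1%R)
  (Hreg : regular _ A B) :
  (forall q : J A B,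
     connected_component setT q = [set q] \/
     exists h : J A B -> Cplx, homeo_on h (connected_component setT q) circle)
  /\
  (* (1) *)
  (exists h : J A B -> Einf _ A,
     forall v : SeqC N, is_linfC _ A v -> K_infinite _ B v ->
       homeo_on h (fiberJ _ A B v) (fiber _ A v) /\
       forall q, fiberJ _ A B v q -> h (sigmaJ _ A B q) = shiftE _ A (h q))
  /\
  (* (2) *)
  (exists h : J A B -> Cplx,
     forall v : SeqC N, is_linfC _ A v -> K_is _ B v 0 -> Aprod_unbounded _ A v ->
       homeo_on h (fiberJ _ A B v) circle /\
       forall q, fiberJ _ A B v q ->
         h (sigmaJ _ A B q) = cpow (h q) (A (v 0%N).1 (v 0%N).2))
  /\
  (* (3) *)
  (forall v : SeqC N, is_linfC _ A v -> K_is _ B v 0 -> ~ Aprod_unbounded _ A v ->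
     exists q : J A B, fiberJ _ A B v = [set q])
  /\
  (* (4) *)
  (exists h : J A B -> (J A B * discrete_topology (seq (Lbl N)))%type,
     (forall v : SeqC N, is_linfC _ A v -> K_is _ B v 0 ->
        forall q, fiberJ _ A B v q -> h q = (q, [::]))
     /\
     forall (v : SeqC N) (K : nat), is_linfC _ A v -> K_is _ B v K -> (0 < K)%N ->
       homeo_on h (fiberJ _ A B v) (fiberJ _ A B (iter K (@shiftC N) v) `*` Pv _ A v K)
       /\ forall q, fiberJ _ A B v q ->
            h (sigmaJ _ A B q) = ((h q).1, dropLast _ (h q).2)).
Proof.
have hb01 := HB01; split; first exact: component_point_or_circle.
split.
  exists (fun q => repr q : Einf N A) => v hv hK; split; first exact: K_infinite_homeo.
  move=> q fq; rewrite sigmaJE; apply: (repr_K_infinite _ _ _ (shiftC N v)).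
    (* A zero of index above [n] along [v] gives one of index at least [n] along its shift. *)
    by move=> n; have [[|k] // nk e] := hK n.+1; exists k.
  by apply: fiber_shift; exact: fq.
split.
  exists (fun q => tail_angle N A 0 (repr q)) => v hv hK hu; split.
    have [x0 fx0] := fiber_nonempty _ _ v hv.
    by rewrite fiberJE -(block0 N A v x0); exact: block_homeo.
  by move=> q fq; exact: tail_angle_sigmaJ.
split; first exact: fiberJ_point.
exists (split_tail N A B); split=> [v hv hK q fq|v K hv hK K0].
  by rewrite (split_tail_repr _ _ _ v 0) //= qpi_repr.
split; first exact: split_tail_homeo.
by move=> q fq; exact: (split_tail_sigmaJ _ _ _ v K).
Qed.
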